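(* Assume there exists a topological $\mathbb Q$-algebra isomorphism $\widehat{\mathrm{per}}\colon(\mathcal Z/\zeta(2)\mathcal Z)[[t]]\to\mathcal Z_{\widehat{\mathcal A}}$ (source with the $t$-adic topology, target with the $\boldsymbol p$-adic topology) such that $\widehat{\mathrm{per}}(t)=\boldsymbol p$ and $\widehat{\mathrm{per}}(\zeta^{0,t}_{\widehat{\mathcal S}}(\mathbf k))=\zeta_{\widehat{\mathcal A}}(\mathbf k)$ for every index $\mathbf k$. Then for every index $\mathbf k$ and every integer $a$, \[\widehat{\mathrm{per}}\bigl(\zeta^{at,(a+1)t}_{\widehat{\mathcal S}}(\mathbf k)\bigr)=\zeta_{\widehat{\mathcal A}}(\mathbf k;a),\] where $\zeta^{at,(a+1)t}_{\widehat{\mathcal S}}(\mathbf k)\in(\mathcal Z/\zeta(2)\mathcal Z)[[t]]$ is obtained from $\zeta^{s,t}_{\widehat{\mathcal S}}(\mathbf k)$ by substituting $s\mapsto at$, $t\mapsto(a+1)t$. Moreover, $\zeta^{s,t}_{\widehat{\mathcal S}}(\mathbf k)$ is the unique element $X(s,t)\in(\mathcal Z/\zeta(2)\mathcal Z)[[s,t]]$ with $\widehat{\mathrm{per}}(X(at,(a+1)t))=\zeta_{\widehat{\mathcal A}}(\mathbf k;a)$ for all integers $a$.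
   Context: $s,t,T$ are commuting indeterminates. An index is a finite tuple $\mathbf{k}=(k_1,\dots,k_r)$ of positive integers ($r\ge0$), $\mathrm{dep}(\mathbf k)=r$, $\mathrm{wt}(\mathbf k)=\sum k_i$; $\mathbf{k}_{[i]}=(k_1,\dots,k_i)$, $\mathbf{k}^{[i]}=(k_{i+1},\dots,k_r)$, $\overleftarrow{\mathbf{k}}=(k_r,\dots,k_1)$; $\oplus$ is componentwise sum and $b\binom{\mathbf{k}}{\mathbf{l}}=\prod_{i}\binom{k_i+l_i-1}{l_i}$. MZVs $\zeta(\mathbf k)$ for admissible $\mathbf k$ (empty or $k_r\ge2$), $\mathcal Z$ the $\mathbb Q$-algebra they generate. $\zeta^{\bullet}(\mathbf k;T)$ is the harmonic or shuffle regularized polynomial: with $\mathfrak H=\mathbb Q\langle e_0,e_1\rangle$, $e_{\mathbf{k}}=e_1e_0^{k_1-1}\cdots e_1e_0^{k_r-1}$, $Z^\bullet_T$ the unique $\mathbb Q$-algebra homomorphism $(\mathbb Q+e_1\mathfrak H,\bullet)\to\mathbb R[T]$ with $Z^\bullet_T(e_{\mathbf k})=(-1)^{\mathrm{dep}}\zeta(\mathbf k)$ for admissible $\mathbf k$ and $Z^\bullet_T(e_1)=-T$, $\zeta^\bullet(\mathbf k;T)=(-1)^{\mathrm{dep}(\mathbf k)}Z^\bullet_T(e_{\mathbf k})$. $\zeta^{t,\bullet}_{\mathrm{shift}}(\mathbf{k};T)=\sum_{\mathbf n\in\mathbb Z_{\ge0}^{\mathrm{dep}(\mathbf k)}}b\binom{\mathbf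 k}{\mathbf n}\zeta^{\bullet}(\mathbf k\oplus\mathbf n;T)(-t)^{\mathrm{wt}(\mathbf n)}$. $\zeta^{s,t}_{\widehat{\mathcal S}}(\mathbf k)$ is the image in $(\mathcal Z/\zeta(2)\mathcal Z)[[s,t]]$ of $\sum_{i=0}^{r}(-1)^{\mathrm{wt}(\mathbf k^{[i]})}\zeta^{s,\bullet}_{\mathrm{shift}}(\mathbf k_{[i]};T)\zeta^{-t,\bullet}_{\mathrm{shift}}(\overleftarrow{\mathbf k^{[i]}};T)$ (independent of $T,\bullet$); $\zeta^{0,t}_{\widehat{\mathcal S}}(\mathbf k)$ is its value at $s=0$ (the $t$-adic symmetric MZV). Finite side: $\mathcal A_n=\bigl(\prod_p\mathbb Z/p^n\mathbb Z\bigr)/\bigl(\bigoplus_p\mathbb Z/p^n\mathbb Z\bigr)$ ($p$ over all primes), $\widehat{\mathcal A}=\varprojlim_n\mathcal A_n$ via the natural projections, $\boldsymbol p=((p\bmod p^n)_p)_n\in\widehat{\mathcal A}$. For an index $\mathbf k$ and $a\in\mathbb Z$, $\zeta_{\widehat{\mathcal A}}(\mathbf k;a)=\bigl(\bigl(\sum_{ap<n_1<\cdots<n_r<(a+1)p}n_1^{-k_1}\cdots n_r^{-k_r}\bmod p^n\bigr)_p\bigr)_n$ and $\zeta_{\widehat{\mathcal A}}(\mathbf k)=\zeta_{\widehat{\mathcal A}}(\mathbf k;0)$ (with $\zeta_{\widehat{\mathcal A}}(\varnothing)=1$). $\mathcal Z_{\widehat{\mathcal A}}$ is the topological $\mathbb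 Q$-algebra ($\boldsymbol p$-adic topology) generated by all $\zeta_{\widehat{\mathcal A}}(\mathbf k)$ and $\boldsymbol p$. *)

(* Defs.v *)
From HB Require Import structures.
From mathcomp Require Import all_boot all_order all_algebra.
From mathcomp Require Import all_classical all_reals all_analysis.
From mathcomp Require Import Rstruct Rstruct_topology.
From Stdlib Require Import ClassicalEpsilon.
From Stdlib Require Rdefinitions.

Set Implicit Arguments.
Unset Strict Implicit.
Unset Printing Implicit Defensive.
Import Order.TTheory GRing.Theory Num.Theory.
Local Open Scope ring_scope.

Notation RR := Rdefinitions.R.

Definition is_index (k : seq nat) : bool := all (fun x => 0 < x)%N k.

Definition admissible (k : seq nat) : bool :=
  is_index k && ((k == [::]) || (1 < last 0%N k)%N).

Definition wt (k : seq nat) : nat := sumn k.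

Definition addseq (k n : seq nat) : seq nat := [seq x.1 + x.2 | x <- zip k n]%N.

Definition bcoef (k n : seq nat) : nat :=
  \prod_(x <- zip k n) 'C(x.1 + x.2 - 1, x.2).

Fixpoint comps (d m : nat) : seq (seq nat) :=
  match d with
  | 0 => if m == 0%N then [:: [::]] else [::]
  | d'.+1 => flatten [seq [seq j :: c | c <- comps d' (m - j)] | j <- iota 0 m.+1]
  end.

(* harmonic (stuffle) product of indices, as a list of indices with
   multiplicity (all coefficients are 1) *)
Fixpoint stuffle (k l : seq nat) {struct k} : seq (seq nat) :=
  match k with
  | [::] => [:: l]
  | a :: k' =>
    let fix aux (l : seq nat) : seq (seq nat) :=
      match l with
      | [::] => [:: k]
      | b :: l' =>
          [seq a :: w | w <- stuffle k' l]
          ++ [seq b :: w | w <- aux l']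
          ++ [seq (a + b)%N :: w | w <- stuffle k' l']
      end in aux l
  end.

(* (n_i integers; terms with n_i = 0 never occur in our uses)          *)

Definition int_range_len (m M : int) : nat :=
  if (m + 1 < M)%R then absz (M - m - 1)%R else 0%N.

Fixpoint hsum (k : seq nat) (m M : int) : rat :=
  match k with
  | [::] => 1
  | a :: k' =>
      \sum_(i < int_range_len m M)
        let n := m + 1 + (i : nat)%:Z in (n%:~R ^- a) * hsum k' n M
  end.

Definition zetaN (k : seq nat) (N : nat) : RR := ratr (hsum k 0 N%:Z).

(* zeta(k) = lim_{N -> oo} sum_{0 < n_1 < ... < n_r < N} ... ; meaningful
   for admissible k *)
Definition zeta (k : seq nat) : RR := limn (zetaN k).

Inductive inZ : RR -> Prop :=
  | inZ_rat (q : rat) : inZ (ratr q)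
  | inZ_zeta (k : seq nat) : admissible k -> inZ (zeta k)
  | inZ_add x y : inZ x -> inZ y -> inZ (x + y)
  | inZ_mul x y : inZ x -> inZ y -> inZ (x * y).

Definition in_z2Z (x : RR) : Prop := exists y, inZ y /\ x = zeta [:: 2%N] * y.

Definition is_har_reg (T : RR) (Z : seq nat -> RR) : Prop :=
  [/\ Z [::] = 1,
      Z [:: 1%N] = T,
      (forall k, admissible k -> Z k = zeta k) &
      (forall k l, is_index k -> is_index l ->
         Z k * Z l = \sum_(w <- stuffle k l) Z w)].

(* zeta^*(k;T): the (unique) stuffle-multiplicative extension *)
Definition zeta_har (T : RR) : seq nat -> RR :=
  epsilon (inhabits (fun _ : seq nat => (0 : RR))) (is_har_reg T).

(* coefficient of u^m in zeta^{u,*}_shift(k; T) with u = sg * (variable):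
   sum_{wt n = m} b(k;n) zeta^*(k (+) n; T) (-sg)^m *)
Definition shift_coef (sg : RR) (T : RR) (k : seq nat) (m : nat) : RR :=
  \sum_(n <- comps (size k) m)
     (bcoef k n)%:R * zeta_har T (addseq k n) * (- sg) ^+ m.

(* coefficient of s^i t^j in (a representative, T = 0, bullet = harmonic, of)
   zeta^{s,t}_S^(k) =
   sum_{r=0}^{dep k} (-1)^{wt k^[r]} zeta^{s,*}_shift(k_[r];T)
                     zeta^{-t,*}_shift(rev k^[r];T) *)
Definition zetaS (k : seq nat) (i j : nat) : RR :=
  \sum_(r < (size k).+1)
    (-1) ^+ wt (drop r k) * shift_coef 1 0 (take r k) i
      * shift_coef (-1) 0 (rev (drop r k)) j.

Definition ser := nat -> RR.
Definition ser2 := nat -> nat -> RR.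

Definition inZser (f : ser) : Prop := forall n, inZ (f n).
Definition inZser2 (F : ser2) : Prop := forall i j, inZ (F i j).

Definition ser_eq (f g : ser) : Prop := forall n, in_z2Z (f n - g n).

Definition ser_add (f g : ser) : ser := fun n => f n + g n.
Definition ser_mul (f g : ser) : ser :=
  fun n => \sum_(i < n.+1) f i * g (n - i)%N.
Definition ser_scale (q : rat) (f : ser) : ser := fun n => ratr q * f n.
Definition ser_one : ser := fun n => if n == 0%N then 1 else 0.
Definition ser_t : ser := fun n => if n == 1%N then 1 else 0.

Definition ser_ord_ge (N : nat) (f : ser) : Prop :=
  forall n, (n < N)%N -> in_z2Z (f n).

Definition subst_st (X : ser2) (a : int) : ser :=
  fun n => \sum_(i < n.+1) X i (n - i)%N * (a%:~R) ^+ i * ((a + 1)%:~R) ^+ (n - i).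

Definition zetaS0 (k : seq nat) : ser := fun j => zetaS k 0 j.

(* The ring A^ = lim_n A_n, A_n = (prod_p Z/p^n)/(oplus_p Z/p^n)        *)
(* An element is represented by x : nat -> nat -> rat, x n p being a    *)
(* representative (in Z_(p)) of the p-component of the n-th level.      *)

Definition Arep := nat -> nat -> rat.

Definition ae_prime (P : nat -> Prop) : Prop :=
  exists B : nat, forall p, prime p -> (B <= p)%N -> P p.

Definition p_integral (p : nat) (x : rat) : bool := coprime `|denq x| p.

Definition congr_pn (p n : nat) (x y : rat) : bool :=
  p_integral p ((x - y) / (p ^ n)%:R).

Definition isA (x : Arep) : Prop :=
  forall n, ae_prime (fun p => p_integral p (x n p)
                               && congr_pn p n (x n.+1 p) (x n p)).

Definition eqA (x y : Arep) : Prop :=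
  forall n, ae_prime (fun p => congr_pn p n (x n p) (y n p)).

Definition addA (x y : Arep) : Arep := fun n p => x n p + y n p.
Definition mulA (x y : Arep) : Arep := fun n p => x n p * y n p.
Definition ratA (q : rat) : Arep := fun _ _ => q.
Definition pA : Arep := fun _ p => p%:R.
Definition scaleA (q : rat) (x : Arep) : Arep := fun n p => q * x n p.

Definition in_pmA (m : nat) (x : Arep) : Prop :=
  exists w, isA w /\ eqA x (fun n p => (p ^ m)%:R * w n p).

Definition zetaA (k : seq nat) (a : int) : Arep :=
  fun _ p => hsum k (a * p%:Z) ((a + 1) * p%:Z).

Inductive algA : Arep -> Prop :=
  | algA_rat q : algA (ratA q)
  | algA_p : algA pA
  | algA_zeta k : is_index k -> algA (zetaA k 0)
  | algA_add x y : algA x -> algA y -> algA (addA x y)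
  | algA_mul x y : algA x -> algA y -> algA (mulA x y).

Definition inZA (x : Arep) : Prop :=
  isA x /\ forall m, exists y, algA y /\ in_pmA m (addA x (scaleA (-1) y)).

Definition is_per_hat (per : ser -> Arep) : Prop :=
      (forall f g, inZser f -> inZser g -> ser_eq f g -> eqA (per f) (per g)) /\
      (forall f, inZser f -> inZA (per f)) /\
      (forall f g, inZser f -> inZser g ->
         eqA (per (ser_add f g)) (addA (per f) (per g))
         /\ eqA (per (ser_mul f g)) (mulA (per f) (per g))) /\
      (forall q f, inZser f -> eqA (per (ser_scale q f)) (scaleA q (per f))) /\
      eqA (per ser_one) (ratA 1) /\
      (forall f g, inZser f -> inZser g -> eqA (per f) (per g) -> ser_eq f g) /\
      (forall x, inZA x -> exists f, inZser f /\ eqA (per f) x) /\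
      (forall m, exists N, forall f, inZser f -> ser_ord_ge N f -> in_pmA m (per f)) /\
      (forall N, exists m, forall f, inZser f -> in_pmA m (per f) -> ser_ord_ge N f) /\
      eqA (per ser_t) pA /\
      (forall k, is_index k -> eqA (per (zetaS0 k)) (zetaA k 0)).

(* Main.v *)
(** The sums [shiftsum f k m] = sum over wt(n) = m of b(k;n) f(k + n) are the
    divided powers [D^m f (k) / m!] of a derivation [D], so they satisfy
    D^m/m! D^n/n! = C(m+n,m) D^(m+n)/(m+n)!, are compatible with reversal and
    obey the Leibniz rule for concatenation. Formally this gives
      zeta_S^(at,(a+1)t)(k) = sum_n b(k;n) (-at)^wt(n) zeta_S^(0,t)(k + n),
    while expanding (ap + n)^-k in powers of ap gives the same expansion of
    zeta_A(k;a) in terms of the zeta_A(k + n); the continuity of [per] matches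
    the two. Uniqueness follows since a homogeneous form in (s,t) is a rational
    combination of its values at the points (a, a+1).

    That the coefficients lie in Z requires the harmonic regularization to
    exist. It is read off from the truncated sums: zeta_N(k) equals a polynomial
    in the harmonic number H_N up to an error which is o(H_N^-m) for every m,
    and the value of this polynomial at T defines the regularization. *)
Require Import Defs.
From mathcomp Require Import all_boot all_order all_algebra.
From mathcomp Require Import all_classical all_reals all_analysis.
From mathcomp Require Import Rstruct Rstruct_topology.
From mathcomp Require Import polyrcf.
From mathcomp Require Import ring lra zify.
From Stdlib Require Import ClassicalEpsilon.
Set Implicit Arguments.
Unset Strict Implicit.
Unset Printing Implicit Defensive.
Import Order.TTheory GRing.Theory Num.Theory.
Import numFieldNormedType.Exports.
Local Open Scope ring_scope.

(** * Truncated sums and the stuffle product *)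

Section ShiftedSums.
Variable F : fieldType.

(* The shift [y = a p] moves the summation range of [zetaA k a] to [0 < n < p]. *)
Fixpoint hs (y : F) (k : seq nat) (x N : nat) : F :=
  if k is a :: k' then \sum_(x.+1 <= n < N) (y + n%:R) ^- a * hs y k' n N else 1.

Lemma hs_geq y a k x N : (N <= x.+1)%N -> hs y (a :: k) x N = 0.
Proof. by move=> h /=; rewrite big_geq. Qed.

Lemma hs_step y a k x N : (x.+1 < N)%N ->
  hs y (a :: k) x N
  = (y + x.+1%:R) ^- a * hs y k x.+1 N + hs y (a :: k) x.+1 N.
Proof. by move=> h /=; rewrite big_ltn. Qed.

Lemma stuffle_nil_r k : stuffle k [::] = [:: k].
Proof. by case: k. Qed.

Lemma stuffle_cons a k b l :
  stuffle (a :: k) (b :: l)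
  = [seq a :: w | w <- stuffle k (b :: l)]
    ++ [seq b :: w | w <- stuffle (a :: k) l]
    ++ [seq (a + b)%N :: w | w <- stuffle k l].
Proof. by []. Qed.

(** Induction on [N - x]. Splitting off the smallest summation value [x.+1] in both factors gives
    four products: the value is used by the first factor, by the second, by both, or by neither. The
    first three match the three branches of [stuffle]. *)
Lemma hs_stuffle y k l x N :
  hs y k x N * hs y l x N = \sum_(w <- stuffle k l) hs y w x N.
Proof.
have [d hd] := ubnP (N - x)%N; elim: d => // d IH in k l x hd *.
case: k => [|a k]; first by rewrite mul1r big_seq1.
case: l => [|b l]; first by rewrite mulr1 stuffle_nil_r big_seq1.
case: (leqP N x.+1) => h.
  rewrite hs_geq // mul0r big1_seq // => w /andP[_].
  rewrite stuffle_cons !mem_cat => /or3P[] /mapP[w' _ ->]; exact: hs_geq.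
rewrite stuffle_cons !big_cat !big_map.
have st c (L : seq (seq nat)) :
    \sum_(w <- L) hs y (c :: w) x N
    = (y + x.+1%:R) ^- c * (\sum_(w <- L) hs y w x.+1 N)
      + \sum_(w <- [seq c :: w | w <- L]) hs y w x.+1 N.
  rewrite big_map mulr_sumr -big_split /=; apply: eq_bigr => w _.
  exact: (hs_step _ _ _ h).
rewrite !st -!IH; try lia.
(* The remainders of the three branches, taken from [x.+1] on, add up to the product in which
   neither factor uses [x.+1]. *)
have := IH (a :: k) (b :: l) x.+1 ltac:(lia).
rewrite stuffle_cons !big_cat (hs_step y a k h) (hs_step y b l h).
have -> : (y + x.+1%:R) ^- (a + b) = (y + x.+1%:R) ^- a * (y + x.+1%:R) ^- b.
  by rewrite exprD invfM.
move: (\sum_(_ <- _) _) (\sum_(_ <- _) _) (\sum_(_ <- _) _) => s1 s2 s3.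
move: (hs y (a :: k) x.+1 N) (hs y (b :: l) x.+1 N) => A B e.
move: (hs y k x.+1 N) (hs y l x.+1 N) (_ ^- a) (_ ^- b) => C D u v.
have -> : s3 = A * B - s2 - s1 by rewrite e /=; ring.
by rewrite /=; ring.
Qed.

(** The recursion of [hs] peels off the smallest summation value; convergence is governed by the
    largest one, which is isolated here. *)
Lemma hs_rcons y k b x N : (x < N)%N ->
  hs y (rcons k b) x N.+1 = hs y (rcons k b) x N + (y + N%:R) ^- b * hs y k x N.
Proof.
elim: k x => [|a k IH] x h /=; first by rewrite big_nat_recr //= mulr1.
rewrite big_nat_recr //=.
have -> : hs y (rcons k b) N N.+1 = 0 by case: (k) => [|? ?]; rewrite hs_geq.
rewrite mulr0 addr0 mulr_sumr -big_split /=.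
apply: eq_big_nat => n /andP[_ hn].
by rewrite IH //; ring.
Qed.

End ShiftedSums.

Lemma hs_ratr (F : numFieldType) y k x N :
  ratr (hs y k x N) = hs (ratr y : F) k x N.
Proof.
elim: k x => [|a k IH] x /=; first by rewrite rmorph1.
rewrite rmorph_sum; apply: eq_bigr => n _.
by rewrite rmorphM /= IH fmorphV rmorphXn rmorphD /= ratr_nat.
Qed.

Lemma hsumE (y : int) k x N :
  hsum k (y + x%:Z) (y + N%:Z) = hs y%:~R k x N.
Proof.
elim: k x => [//|a k IH] x /=.
have -> : int_range_len (y + x) (y + N) = (N - x.+1)%N.
  by rewrite /int_range_len; case: ifP => h; lia.
rewrite -[in RHS](add0n x.+1) big_addn big_mkord; apply: eq_bigr => i _.
have -> : y + x + 1 + (i : nat)%:Z = y + (i + x.+1)%:Z by lia.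
by rewrite IH rmorphD.
Qed.

Lemma zetaN_hs k N : zetaN k N = hs 0 k 0 N.
Proof. by rewrite /zetaN -(rmorph0 (@ratr RR)) -hs_ratr -(hsumE 0) !add0r. Qed.

(** * Stuffle products with the index (1), graded by trailing ones *)

(** For m = 0 these are the nonempty admissible indices. Words consisting of ones only are excluded
    and treated separately. *)
Definition trailing_ones_le (m : nat) (w : seq nat) : Prop :=
  is_index w /\ exists u b j, [/\ w = u ++ b :: nseq j 1%N, (1 < b)%N & (j <= m)%N].

Lemma trailing_ones_le_cons m a w :
  (0 < a)%N -> trailing_ones_le m w -> trailing_ones_le m (a :: w).
Proof.
move=> a0 [iw [u [b [j [ew hb hj]]]]]; split; first by apply/andP; split.
by exists (a :: u), b, j; rewrite ew.
Qed.

Lemma trailing_ones_leW m m' w :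
  (m <= m')%N -> trailing_ones_le m w -> trailing_ones_le m' w.
Proof.
move=> mm [iw [u [b [j [ew hb hj]]]]]; split => //.
by exists u, b, j; split => //; lia.
Qed.

Lemma is_index_cons a k : is_index (a :: k) = (0 < a)%N && is_index k.
Proof. by []. Qed.

Lemma is_index_cat k l : is_index (k ++ l) = is_index k && is_index l.
Proof. exact: all_cat. Qed.

Lemma is_index_nseq1 m : is_index (nseq m 1%N).
Proof. by rewrite /is_index all_nseq orbT. Qed.

Lemma stuffle_cons1 a k :
  stuffle (a :: k) [:: 1%N]
  = [seq a :: w | w <- stuffle k [:: 1%N]] ++ [:: 1%N :: a :: k; (a + 1)%N :: k].
Proof. by rewrite stuffle_cons !stuffle_nil_r. Qed.

(** Each insertion of a further 1 gives the same word, while a merger creates an entry 2 followed by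
    at most m - 1 ones. The list [L] is chosen before [f], so one identity serves every truncation
    bound at once. *)
Lemma stuffle_nseq1 m : exists2 L,
  forall w, w \in L -> trailing_ones_le m.-1 w &
  forall (V : nmodType) (f : seq nat -> V),
    \sum_(w <- stuffle (nseq m 1%N) [:: 1%N]) f w
    = f (nseq m.+1 1%N) *+ m.+1 + \sum_(w <- L) f w.
Proof.
elim: m => [|m [L hL eL]].
  by exists [::] => // V f; rewrite big_seq1 big_nil addr0.
exists ([seq 1%N :: w | w <- L] ++ [:: 2%N :: nseq m 1%N]) => [w|V f].
  rewrite mem_cat mem_seq1 => /orP[/mapP[w' /hL h ->]|/eqP ->].
    by apply: trailing_ones_le_cons => //; apply: trailing_ones_leW h; lia.
  split; first by rewrite is_index_cons is_index_nseq1.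
  by exists [::], 2%N, m; split.
rewrite [nseq m.+1 _]/= stuffle_cons1 !big_cat !big_map /=.
rewrite (eL V (fun w => f (1%N :: w))) !big_cons !big_nil addr0 [in RHS]mulrS.
by rewrite /= addrACA; congr (_ + _); rewrite addrC.
Qed.

(** The m + 1 insertions behind [b] all lengthen the final run of ones; inserting earlier, or
    merging with any entry, leaves at most m trailing ones. *)
Lemma stuffle_trailing_ones u b m : is_index u -> (1 < b)%N -> exists2 L,
  forall w, w \in L -> trailing_ones_le m w &
  forall (V : nmodType) (f : seq nat -> V),
    \sum_(w <- stuffle (u ++ b :: nseq m 1%N) [:: 1%N]) f w
    = f (u ++ b :: nseq m.+1 1%N) *+ m.+1 + \sum_(w <- L) f w.
Proof.
move=> iu hb; elim: u iu => [|a u IH] iu.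
  have [L hL eL] := stuffle_nseq1 m.
  exists ([seq b :: w | w <- L]
          ++ [:: 1%N :: b :: nseq m 1%N; (b + 1)%N :: nseq m 1%N]) => [w|V f].
    rewrite mem_cat !inE => /or3P[/mapP[w' /hL h ->]|/eqP ->|/eqP ->].
    - by apply: trailing_ones_le_cons; [lia|apply: trailing_ones_leW h; lia].
    - split; first by rewrite !is_index_cons is_index_nseq1 andbT; lia.
      by exists [:: 1%N], b, m.
    - split; first by rewrite !is_index_cons is_index_nseq1 andbT; lia.
      by exists [::], (b + 1)%N, m; split => //; lia.
  rewrite cat0s stuffle_cons1 !big_cat !big_map (eL V (fun w => f (b :: w))).
  by rewrite addrA.
move: iu; rewrite is_index_cons => /andP[a0] /[dup] iu /IH [L hL eL].
have tw : trailing_ones_le m (u ++ b :: nseq m 1%N).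
  split; last by exists u, b, m.
  by rewrite is_index_cat iu is_index_cons is_index_nseq1 andbT /=; lia.
exists ([seq a :: w | w <- L] ++ [:: 1%N :: a :: (u ++ b :: nseq m 1%N);
   (a + 1)%N :: (u ++ b :: nseq m 1%N)]) => [w|V f].
  rewrite mem_cat !inE => /or3P[/mapP[w' /hL h ->]|/eqP ->|/eqP ->].
  - exact: trailing_ones_le_cons.
  - by do 2!apply: trailing_ones_le_cons => //.
  - by apply: trailing_ones_le_cons => //; lia.
rewrite cat_cons stuffle_cons1 !big_cat !big_map (eL V (fun w => f (a :: w))).
by rewrite addrA.
Qed.

Lemma index_trailing_ones w : is_index w ->
  w = nseq (size w) 1%N \/ trailing_ones_le (size w) w.
Proof.
elim: w => [|a w IH] /=; first by left.
case/andP=> a0 /[dup] iw /IH [e|h]; last first.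
  by right; apply: trailing_ones_le_cons => //; apply: trailing_ones_leW h.
have [a1|a1] := leqP a 1; first by left; rewrite -e; congr (_ :: _); lia.
right; split; first by rewrite is_index_cons a0.
by exists [::], a, (size w); rewrite -e; split => //; lia.
Qed.

Section StuffleGenerated.
Variables (F : numFieldType) (I : Type) (f : seq nat -> I -> F).
Variable S : (I -> F) -> Prop.
Hypothesis S_add : forall u v, S u -> S v -> S (fun i => u i + v i).
Hypothesis S_mul : forall u v, S u -> S v -> S (fun i => u i * v i).
Hypothesis S_rat : forall (q : rat) u, S u -> S (fun i => ratr q * u i).
Hypothesis f_adm : forall k, admissible k -> S (f k).
Hypothesis f_one : S (f [:: 1%N]).
Hypothesis f_stuffle : forall k i, is_index k ->
  f k i * f [:: 1%N] i = \sum_(w <- stuffle k [:: 1%N]) f w i.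

Lemma subalg_sum (L : seq (seq nat)) :
  (forall w, w \in L -> S (f w)) -> S (fun i => \sum_(w <- L) f w i).
Proof.
elim: L => [|w L IH] hL.
  have h0 : S (f [::]) by apply: f_adm.
  rewrite (_ : (fun _ => _) = (fun i => ratr 0 * f [::] i)); first exact: S_rat.
  by apply/funext => i; rewrite big_nil rmorph0 mul0r.
rewrite (_ : (fun _ => _) = (fun i => f w i + \sum_(w <- L) f w i)).
  apply: S_add; first by apply: hL; rewrite inE eqxx.
  by apply: IH => w' h; apply: hL; rewrite inE h orbT.
by apply/funext => i; rewrite big_cons.
Qed.

(* Multiplication by the index (1) is triangular with respect to the number of
   trailing ones, so all values are polynomials in [f [:: 1]] over the
   admissible ones. *)
Lemma solve_stuffle k w L m : is_index k ->
  (forall i, \sum_(w <- stuffle k [:: 1%N]) f w i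
    = f w i *+ m.+1 + \sum_(w <- L) f w i) ->
  S (f k) -> (forall w, w \in L -> S (f w)) -> S (f w).
Proof.
move=> ik e Sk SL.
rewrite (_ : f w = (fun i => ratr (m.+1%:R^-1) *
   (f k i * f [:: 1%N] i + ratr (-1) * \sum_(w <- L) f w i))).
  by apply: S_rat; apply: S_add; [exact: S_mul|apply: S_rat; exact: subalg_sum].
apply/funext => i; rewrite f_stuffle // e rmorphN1 mulN1r addrK fmorphV /= ratr_nat.
by rewrite -[f w i *+ _]mulr_natl mulKf // pnatr_eq0.
Qed.

Lemma subalg_trailing_ones m w : trailing_ones_le m w -> S (f w).
Proof.
elim: m w => [|m IH] w [iw [u [b [j [ew hb hj]]]]].
  (* With no trailing ones the last entry is [b > 1]. *)
  apply: f_adm; rewrite /admissible iw ew last_cat /=.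
  by move: hj; case: j {ew} => //= _; rewrite hb orbT.
move: iw; rewrite ew is_index_cat => /andP[iu ib].
move: hj; rewrite leq_eqVlt ltnS => /orP[/eqP ej|hj]; last first.
  apply: IH; split; last by exists u, b, j.
  by rewrite is_index_cat iu ib.
have tk : trailing_ones_le m (u ++ b :: nseq m 1%N).
  split; last by exists u, b, m.
  by rewrite is_index_cat iu is_index_cons is_index_nseq1 andbT /=; lia.
have [L hL eL] := stuffle_trailing_ones m iu hb.
rewrite ej; apply: (solve_stuffle (k := u ++ b :: nseq m 1%N) (L := L) (m := m)).
- by case: tk.
- by move=> i; rewrite (eL F (fun w => f w i)).
- exact: IH.
- by move=> w' /hL; exact: IH.
Qed.

(** The parameter set [I] allows two uses: functions of the truncation bound that have an expansion,
    and, with [I] a point, membership of regularized values in [inZ]. *)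
Lemma stuffle_generated k : is_index k -> S (f k).
Proof.
move=> /index_trailing_ones [->|]; last exact: subalg_trailing_ones.
(* Words of ones need their own induction on length; their remainder words all contain an entry
   above 1. *)
elim: (size k) => [|m IH]; first exact: f_adm.
have [L hL eL] := stuffle_nseq1 m.
apply: (solve_stuffle (k := nseq m 1%N) (L := L) (m := m)) => //.
- exact: is_index_nseq1.
- by move=> i; rewrite (eL F (fun w => f w i)).
- by move=> w /hL; exact: subalg_trailing_ones.
Qed.

End StuffleGenerated.

(** * Regularization by harmonic asymptotics *)

Section HarmonicAsymptotics.
Local Open Scope classical_set_scope.
Variable R : realType.

Definition harmonic_sum (N : nat) : R := hs 0 [:: 1%N] 0 N.
Local Notation H := harmonic_sum.

Lemma harmonic_sumE N : H N = \sum_(1 <= n < N) n%:R^-1.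
Proof. by apply: eq_bigr => n _; rewrite mulr1 add0r. Qed.

Lemma harmonic_sumS N : H N.+2 = H N.+1 + N.+1%:R^-1.
Proof. by rewrite !harmonic_sumE big_nat_recr. Qed.

Lemma harmonic_sum1 : H 1 = 0.
Proof. by rewrite harmonic_sumE big_geq. Qed.

Lemma invn_ge0 n : 0 <= n%:R^-1 :> R.
Proof. by rewrite invr_ge0 ler0n. Qed.

Lemma harmonic_sum_ge0 N : 0 <= H N.
Proof. by rewrite harmonic_sumE; apply: sumr_ge0 => n _; exact: invn_ge0. Qed.

Lemma harmonic_sum_homo : {homo H : m n / (m <= n)%N >-> m <= n}.
Proof.
apply: homo_leq => [//|? ? ?|[|n]]; first exact: le_trans.
  by rewrite harmonic_sum1 harmonic_sumE big_geq.
by rewrite harmonic_sumS lerDl invn_ge0.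
Qed.

Lemma harmonic_sum_unbounded (A : R) : exists N, A < H N.
Proof.
apply: contrapT => hn; apply: (@dvg_harmonic R).
apply: nondecreasing_is_cvgn.
  by apply: nondecreasing_series => n _; rewrite harmonic_ge0.
exists A => _ [N _ <-].
have -> : series harmonic N = H N.+1.
  by rewrite /series /= harmonic_sumE big_add1.
by rewrite leNgt; apply/negP => h; apply: hn; exists N.+1.
Qed.

Lemma subrX_le (a b : R) M : 0 <= b <= a ->
  a ^+ M.+1 - b ^+ M.+1 <= M.+1%:R * a ^+ M * (a - b).
Proof.
move=> /andP[b0 ba]; elim: M => [|M IH]; first by rewrite !expr1 expr0 !mul1r.
have a0 := le_trans b0 ba.
have hb : b ^+ M.+1 <= a ^+ M.+1 by rewrite lerXn2r.
have -> : a ^+ M.+2 - b ^+ M.+2 = a * (a ^+ M.+1 - b ^+ M.+1) + (a - b) * b ^+ M.+1.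
  by rewrite !exprS; ring.
have h1 : (a - b) * b ^+ M.+1 <= (a - b) * a ^+ M.+1.
  by apply: ler_wpM2l => //; rewrite subr_ge0.
apply: le_trans (lerD (ler_wpM2l a0 IH) h1) _.
by rewrite -[M.+2%:R]natr1 exprS le_eqVlt; apply/orP; left; apply/eqP; ring.
Qed.

(** Summation by parts: the difference moves onto the power of [H], whose increment is at most (M+1)
    H^M / n, and 1/n^2 <= 2 (1/n - 1/(n+1)) brings back a sum of the same shape with exponent one
    lower. *)
Lemma telescoping_sum_bounded M : exists B : R, forall N,
  \sum_(1 <= n < N) H n.+1 ^+ M * (n%:R^-1 - n.+1%:R^-1) <= B.
Proof.
have d0 n : (0 < n)%N -> 0 <= n%:R^-1 - n.+1%:R^-1 :> R.
  by move=> h; rewrite subr_ge0 lef_pV2 ?posrE ?ltr0n // ler_nat.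
elim: M => [|M [B hB]].
  exists 1 => -[|N]; first by rewrite big_geq.
  under eq_bigr do rewrite expr0 mul1r.
  suff -> : \sum_(1 <= n < N.+1) (n%:R^-1 - n.+1%:R^-1) = 1 - N.+1%:R^-1 :> R.
    by rewrite lerBlDr lerDl invn_ge0.
  elim: N => [|N IH]; first by rewrite big_geq // invr1 subrr.
  by rewrite big_nat_recr //= IH; ring.
exists (M.+1%:R * (2 * B)) => -[|N].
  by rewrite big_geq //; have := hB 0%N; rewrite big_geq // => h; rewrite !mulr_ge0.
apply: (@le_trans _ _ (M.+1%:R * (2 *
    (\sum_(1 <= n < N.+1) H n.+1 ^+ M * (n%:R^-1 - n.+1%:R^-1))))); last first.
  by rewrite ler_wpM2l // ler_wpM2l // hB.
have h0 : 0 <= H N.+1 ^+ M.+1 * N.+1%:R^-1.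
  by rewrite mulr_ge0 ?invn_ge0 ?exprn_ge0 // harmonic_sum_ge0.
(* The boundary term is added on the left so that the induction on [N] closes: the left side then
   grows by exactly (H_{N+2}^{M+1} - H_{N+1}^{M+1}) / (N+1). *)
suff : \sum_(1 <= n < N.+1) H n.+1 ^+ M.+1 * (n%:R^-1 - n.+1%:R^-1)
    + H N.+1 ^+ M.+1 * N.+1%:R^-1 <= M.+1%:R * (2 *
    (\sum_(1 <= n < N.+1) H n.+1 ^+ M * (n%:R^-1 - n.+1%:R^-1))).
  by apply: le_trans; rewrite lerDl.
clear h0; elim: N => [|N IH]; first by rewrite !big_geq // harmonic_sum1 expr0n !mulr0 mul0r.
rewrite big_nat_recr // [in leRHS]big_nat_recr //=.
have hx := @subrX_le (H N.+2) (H N.+1) M; rewrite harmonic_sum_ge0 harmonic_sum_homo // in hx.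
have {}hx := hx isT.
have e : H N.+2 - H N.+1 = N.+1%:R^-1 by rewrite harmonic_sumS addrC addKr.
have p1 : 0 < N.+1%:R^-1 :> R by rewrite invr_gt0.
have hd : N.+1%:R^-1 * N.+1%:R^-1 <= 2 * (N.+1%:R^-1 - N.+2%:R^-1) :> R.
  rewrite -[N.+2%:R]natr1; have : 1 <= N.+1%:R :> R by rewrite ler1n.
  move: N.+1%:R => x x1; have x0 : 0 < x by lra.
  rewrite -subr_ge0.
  have -> : 2 * (x^-1 - (x + 1)^-1) - x^-1 * x^-1 = (x - 1) / (x * x * (x + 1)).
    by field; apply/andP; split; apply/lt0r_neq0; lra.
  by rewrite divr_ge0 ?subr_ge0 // !mulr_ge0 //; lra.
rewrite e in hx.
have := ler_wpM2r (ltW p1) hx.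
have hm : 0 <= M.+1%:R * H N.+2 ^+ M by rewrite mulr_ge0 // exprn_ge0 // harmonic_sum_ge0.
have := ler_wpM2l hm hd.
move: IH; move: (\sum_(_ <= _ < _) _) (\sum_(_ <= _ < _) _) => s1 s2.
move: (H N.+2 ^+ M.+1) (H N.+1 ^+ M.+1) (H N.+2 ^+ M) N.+2%:R^-1 N.+1%:R^-1.
move: M.+1%:R => c X Y Z q2 q h1 h2 h3; nra.
Qed.

(** * Convergence of admissible sums by comparison *)

Definition weighted_sum (M N : nat) : R := \sum_(1 <= n < N) H n ^+ M / n%:R ^+ 2.

Lemma weighted_sum_term_ge0 M n : 0 <= H n ^+ M / n%:R ^+ 2.
Proof. by rewrite divr_ge0 ?exprn_ge0 ?harmonic_sum_ge0. Qed.

Lemma weighted_sum_nondecreasing M : {homo weighted_sum M : m n / (m <= n)%N >-> m <= n}.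
Proof.
apply: homo_leq => [//|? ? ?|[|n]]; first exact: le_trans.
  by rewrite /weighted_sum !big_geq.
by rewrite /weighted_sum [leRHS]big_nat_recr //= lerDl weighted_sum_term_ge0.
Qed.

Lemma weighted_sum_is_cvg M : cvgn (weighted_sum M).
Proof.
apply: nondecreasing_is_cvgn; first exact: weighted_sum_nondecreasing.
have [B hB] := telescoping_sum_bounded M.
exists (2 * B) => _ [N _ <-].
apply: le_trans (ler_wpM2l _ (hB N)) => //; rewrite /weighted_sum mulr_sumr.
apply: ler_sum_nat => n /andP[n1 _].
rewrite [leRHS]mulrCA; apply: ler_pM.
- by rewrite exprn_ge0 // harmonic_sum_ge0.
- by rewrite invr_ge0 exprn_ge0.
- by rewrite lerXn2r ?nnegrE ?harmonic_sum_ge0 // harmonic_sum_homo.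
rewrite -[n.+1%:R]natr1; have : 1 <= n%:R :> R by rewrite ler1n.
move: n%:R => x x1; have x0 : 0 < x by lra.
rewrite -subr_ge0.
have -> : 2 * (x^-1 - (x + 1)^-1) - (x ^+ 2)^-1 = (x - 1) / (x * x * (x + 1)).
  by field; apply/andP; split; apply/lt0r_neq0; lra.
by rewrite divr_ge0 ?subr_ge0 // !mulr_ge0 //; lra.
Qed.

Lemma weighted_sum_tail_cvg0 M :
  (fun N => limn (weighted_sum M) - weighted_sum M N) @ \oo --> (0 : R).
Proof.
rewrite -(subrr (limn (weighted_sum M))).
by apply: cvgB; [exact: cvg_cst|exact: (@weighted_sum_is_cvg M)].
Qed.

Lemma hs_ge0 k x N : 0 <= hs (0 : R) k x N.
Proof.
elim: k x => [|a k IH] x //=; apply: sumr_ge0 => n _.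
by rewrite mulr_ge0 // invr_ge0 exprn_ge0 // add0r.
Qed.

Lemma hs_le_harmonic_sumX k x N : is_index k -> hs (0 : R) k x N <= H N ^+ size k.
Proof.
elim: k x => [|a k IH] x //; rewrite is_index_cons => /andP[a0 ik].
apply: (@le_trans _ _ (\sum_(x.+1 <= n < N) n%:R^-1 * H N ^+ size k)).
  apply: ler_sum_nat => n /andP[n1 _]; rewrite add0r.
  apply: ler_pM => //; rewrite ?invr_ge0 ?exprn_ge0 ?hs_ge0 //; last exact: IH.
  have n0 : 1 <= n%:R :> R by rewrite ler1n; lia.
  rewrite lef_pV2 ?posrE ?exprn_gt0 ?(lt_le_trans ltr01) //.
  by case: a a0 => // a _; rewrite exprS ler_peMr ?exprn_ege1 // (le_trans ler01).
rewrite -mulr_suml exprS ler_wpM2r ?exprn_ge0 ?harmonic_sum_ge0 // harmonic_sumE.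
have [h|h] := leqP N x.+1; first by rewrite big_geq // sumr_ge0 // => n _; exact: invn_ge0.
rewrite [leRHS](@big_cat_nat _ _ _ x.+1) //=; last exact: ltnW.
by rewrite lerDr sumr_ge0 // => n _; exact: invn_ge0.
Qed.

Lemma admissible_rcons k : admissible k ->
  k = [::] \/ exists k' a, [/\ k = rcons k' a, is_index k' & (1 < a)%N].
Proof.
case/lastP: k => [|k a]; first by left.
rewrite /admissible last_rcons /is_index all_rcons => /andP[/andP[_ ik] h].
right; exists k, a; split => //.
by case/orP: h => // /eqP; case: (k).
Qed.

(** A new largest value n contributes at most H_n^{size k} / n^2, and [H N ^+ m] is absorbed into
    H_n^m by monotonicity. Hence tails of admissible sums stay small even after multiplication by
    powers of [H N]. *)
Lemma hs_rcons_increment k a m N N' : is_index k -> (1 < a)%N -> (0 < N <= N')%N ->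
  0 <= H N ^+ m * (hs 0 (rcons k a) 0 N' - hs 0 (rcons k a) 0 N)
    <= weighted_sum (m + size k) N' - weighted_sum (m + size k) N.
Proof.
move=> ik a1 /andP[N0 /subnKC <-]; move: (N' - N)%N => i.
elim: i => [|i /andP[IH1 IH2]]; first by rewrite addn0 !subrr mulr0 lexx.
rewrite addnS hs_rcons; last by lia.
rewrite /weighted_sum big_nat_recr /=; last by lia.
rewrite -/(weighted_sum (m + size k) _) add0r.
set n := (N + i)%N in IH1 IH2 *.
have -> x y w : H N ^+ m * (x + y - w) = H N ^+ m * (x - w) + H N ^+ m * y by move=> *; ring.
have -> x y w : x + y - w = (x - w) + y :> R by move=> *; ring.
have n1 : 1 <= n%:R :> R by rewrite ler1n /n; lia.
have h0 : 0 <= n%:R ^- a * hs (0 : R) k 0 n by rewrite mulr_ge0 ?hs_ge0 // invr_ge0 exprn_ge0.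
apply/andP; split.
  by rewrite addr_ge0 // mulr_ge0 // exprn_ge0 // harmonic_sum_ge0.
apply: lerD => //; rewrite exprD -mulrA [in leRHS](mulrC _ (_ ^-1)).
apply: ler_pM; rewrite ?exprn_ge0 ?harmonic_sum_ge0 //.
  by rewrite lerXn2r ?nnegrE ?harmonic_sum_ge0 // harmonic_sum_homo // /n leq_addr.
apply: ler_pM; rewrite ?hs_ge0 ?invr_ge0 ?exprn_ge0 //; last exact: hs_le_harmonic_sumX.
by rewrite lef_pV2 ?posrE ?exprn_gt0 ?(lt_le_trans ltr01) // ler_weXn2l.
Qed.

Lemma hs_rcons_is_cvg k a : is_index k -> (1 < a)%N ->
  cvgn (hs (0 : R) (rcons k a) 0).
Proof.
move=> ik a1; apply: nondecreasing_is_cvgn.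
  apply: homo_leq => [//|? ? ?|[|n]]; first exact: le_trans.
    by case: (k) => [|? ?]; rewrite /= !big_geq.
  have /andP[h _] := @hs_rcons_increment k a 0 n.+1 n.+2 ik a1 (leqnSn _).
  by move: h; rewrite expr0 mul1r subr_ge0.
exists (limn (weighted_sum (size k))) => _ [N _ <-].
apply: le_trans (nondecreasing_cvgn_le (@weighted_sum_nondecreasing _) (@weighted_sum_is_cvg _) N).
case: N => [|N]; first by case: (k) => [|? ?]; rewrite /= /weighted_sum !big_geq.
have /andP[_] := @hs_rcons_increment k a 0 1 N.+1 ik a1 (ltn0Sn _).
rewrite expr0 mul1r add0n [weighted_sum _ 1]/weighted_sum big_geq // !subr0.
by case: (k) => [|? ?]; rewrite /= [X in _ - X]big_geq // subr0.
Qed.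

(** * Negligible functions and polynomial expansions in the harmonic number *)

(** Decay against every power of [H N], so that errors remain negligible when multiplied by
    polynomials in [H N], as products of expansions demand. *)
Definition negligible (u : nat -> R) : Prop :=
  forall m, (fun N => H N ^+ m * u N) @ \oo --> (0 : R).

(** Letting N' tend to infinity in [hs_rcons_increment] squeezes the weighted tail between 0 and the
    tail of a convergent [weighted_sum]. *)
Lemma negligible_limn k a : is_index k -> (1 < a)%N ->
  negligible (fun N => limn (hs (0 : R) (rcons k a) 0) - hs 0 (rcons k a) 0 N).
Proof.
move=> ik a1 m; set z := hs 0 (rcons k a) 0.
have cz : cvgn z := hs_rcons_is_cvg ik a1.
apply: (@squeeze_cvgr _ _ _ _ (cst 0)
  (fun N => limn (weighted_sum (m + size k)) - weighted_sum (m + size k) N));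
  last 2 first.
- exact: cvg_cst.
- exact: weighted_sum_tail_cvg0.
exists 1%N => // N /= N1.
have cf : (fun N' => H N ^+ m * (z N' - z N)) @ \oo --> H N ^+ m * (limn z - z N).
  apply: cvgM; first exact: cvg_cst.
  by apply: cvgB => //; exact: cvg_cst.
rewrite -(cvg_lim _ cf) //; apply/andP; split.
  apply: limr_ge; first by apply/cvg_ex; eexists; exact: cf.
  exists N => // N' /= h.
  have hN : (0 < N <= N')%N by rewrite N1.
  by have /andP[] := hs_rcons_increment m ik a1 hN.
apply: limr_le; first by apply/cvg_ex; eexists; exact: cf.
exists N => // N' /= h.
have hN : (0 < N <= N')%N by rewrite N1.
have /andP[_ h'] := hs_rcons_increment m ik a1 hN; apply: le_trans h' _.
apply: lerD => //; apply: nondecreasing_cvgn_le; first exact: weighted_sum_nondecreasing.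
exact: weighted_sum_is_cvg.
Qed.

Lemma negligibleD u v : negligible u -> negligible v -> negligible (fun N => u N + v N).
Proof.
move=> hu hv m; rewrite -(addr0 0) (_ : (fun N => _) =
  (fun N => H N ^+ m * u N) + (fun N => H N ^+ m * v N)); first exact: cvgD.
by apply/funext => N; rewrite mulrDr.
Qed.

Lemma negligibleM u v : negligible u -> negligible v -> negligible (fun N => u N * v N).
Proof.
move=> hu hv m; rewrite -(mulr0 0) (_ : (fun N => _) =
  (fun N => H N ^+ 0 * u N) \* (fun N => H N ^+ m * v N)); first exact: cvgM.
by apply/funext => N /=; rewrite expr0 mul1r mulrCA.
Qed.

Lemma negligible_horner (p : {poly R}) u :
  negligible u -> negligible (fun N => p.[H N] * u N).
Proof.
elim/poly_ind: p u => [|p c IH] u hu.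
  move=> m; rewrite (_ : (fun N => _) = cst 0); first exact: cvg_cst.
  by apply/funext => N; rewrite horner0 mul0r mulr0.
have hHu : negligible (fun N => H N * u N).
  move=> m; rewrite (_ : (fun N => _) = (fun N => H N ^+ m.+1 * u N)) //.
  by apply/funext => N; rewrite exprSr mulrA.
have hcu : negligible (fun N => c * u N).
  move=> m; rewrite -(mulr0 c) (_ : (fun N => _) =
    (cst c) \* (fun N => H N ^+ m * u N)); first by apply: cvgM => //; exact: cvg_cst.
  by apply/funext => N /=; rewrite mulrCA.
rewrite (_ : (fun N => _) = (fun N => p.[H N] * (H N * u N) + c * u N)).
  by apply: negligibleD => //; exact: IH.
by apply/funext => N; rewrite hornerMXaddC mulrDl mulrA.
Qed.

Definition expansion (u : nat -> R) (p : {poly R}) : Prop :=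
  negligible (fun N => u N - p.[H N]).

Lemma negligible0 : negligible (fun=> 0).
Proof.
move=> m; rewrite (_ : (fun N => _) = cst 0); first exact: cvg_cst.
by apply/funext => N; rewrite mulr0.
Qed.

Lemma expansion_horner p : expansion (fun N => p.[H N]) p.
Proof. by rewrite /expansion; under eq_fun do rewrite subrr; exact: negligible0. Qed.

Lemma expansionD u v p q :
  expansion u p -> expansion v q -> expansion (fun N => u N + v N) (p + q).
Proof.
move=> hu hv; have := negligibleD hu hv; congr negligible.
by apply/funext => N; rewrite hornerD; ring.
Qed.

Lemma expansionM u v p q :
  expansion u p -> expansion v q -> expansion (fun N => u N * v N) (p * q).
Proof.
move=> hu hv.
have := negligibleD (negligibleM hu hv)
  (negligibleD (negligible_horner p hv) (negligible_horner q hu)).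
by congr negligible; apply/funext => N; rewrite hornerM; ring.
Qed.

Lemma expansion_sum (L : seq (seq nat)) (u : seq nat -> nat -> R) p :
  (forall w, w \in L -> expansion (u w) (p w)) ->
  expansion (fun N => \sum_(w <- L) u w N) (\sum_(w <- L) p w).
Proof.
elim: L => [|w L IH] h.
  rewrite big_nil (_ : (fun N => _) = (fun N => (0 : {poly R}).[H N])).
    exact: expansion_horner.
  by apply/funext => N; rewrite big_nil horner0.
rewrite big_cons (_ : (fun N => _) = (fun N => u w N + \sum_(w <- L) u w N)).
  apply: expansionD; first by apply: h; rewrite inE eqxx.
  by apply: IH => w' h'; apply: h; rewrite inE h' orbT.
by apply/funext => N; rewrite big_cons.
Qed.

(** A polynomial with positive leading coefficient is at least that coefficient at all large
    arguments, and [H] is unbounded, so its values along [H] cannot tend to 0. *)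
Lemma negligible_horner_lead_le0 (p : {poly R}) :
  negligible (fun N => p.[H N]) -> lead_coef p <= 0.
Proof.
move=> hp; rewrite leNgt; apply/negP => l0.
have [x hx] := poly_pinfty_gt_lc l0.
have [N hN] := harmonic_sum_unbounded x.
have := hp 0%N; under eq_fun do rewrite expr0 mul1r.
move=> /cvgr_lt /(_ _ l0) [M _ hM].
have := hM (maxn N M); rewrite /= leq_maxr ltNge => /(_ isT)/negP; apply; apply: hx.
by apply: le_trans (ltW hN) _; apply: harmonic_sum_homo; rewrite leq_maxl.
Qed.

(** The sign bound applied to p - q and to q - p forces a zero leading coefficient. Uniqueness
    transfers the stuffle identities from sums to polynomials. *)
Lemma expansion_inj u p q : expansion u p -> expansion u q -> p = q.
Proof.
have le0 p' q' : expansion u p' -> expansion u q' -> lead_coef (p' - q') <= 0.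
  move=> hp hq; apply: negligible_horner_lead_le0.
  have := negligibleD hq (negligible_horner (-1)%:P hp); congr negligible.
  by apply/funext => N; rewrite hornerC hornerD hornerN; ring.
move=> hp hq; apply/eqP; rewrite -subr_eq0 -lead_coef_eq0 eq_le le0 //=.
by rewrite -oppr_le0 -lead_coefN opprB le0.
Qed.

Lemma expansion_cst (c : R) : expansion (fun=> c) c%:P.
Proof.
by have := expansion_horner c%:P; congr expansion; apply/funext => N; rewrite hornerC.
Qed.

Lemma expansion_H : expansion H 'X.
Proof.
by have := expansion_horner 'X; congr expansion; apply/funext => N; rewrite hornerX.
Qed.

Lemma admissible_expansion k :
  admissible k -> expansion (hs 0 k 0) (limn (hs (0 : R) k 0))%:P.
Proof.
move=> /admissible_rcons [->|[k' [a [-> ik a1]]]].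
  rewrite (_ : limn _ = (1 : R)); first exact: (expansion_cst 1).
  by apply: cvg_lim => //; exact: cvg_cst.
have := negligible_horner (-1)%:P (negligible_limn ik a1); congr negligible.
by apply/funext => N; rewrite !hornerC mulN1r opprB.
Qed.

Lemma hs_expansion k : is_index k -> exists p, expansion (hs 0 k 0) p.
Proof.
move=> ik; apply: (@stuffle_generated R nat (fun k => hs 0 k 0)
  (fun u => exists p, expansion u p) _ _ _ _ _ _ k ik).
- by move=> u v [p hp] [q hq]; exists (p + q); exact: expansionD.
- by move=> u v [p hp] [q hq]; exists (p * q); exact: expansionM.
- move=> q u [p hp]; exists ((ratr q)%:P * p).
  exact: (expansionM (expansion_cst _)).
- by move=> w /admissible_expansion hw; eexists; exact: hw.
- by exists 'X; exact: expansion_H.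
- by move=> w N _; rewrite hs_stuffle.
Qed.

End HarmonicAsymptotics.

(** * Existence of the harmonic regularization and its values at T = 0 *)

Lemma is_index_stuffle k l w :
  is_index k -> is_index l -> w \in stuffle k l -> is_index w.
Proof.
elim: k l w => [|a k IHk] l w ik; first by rewrite mem_seq1 => il /eqP ->.
elim: l w => [|b l IHl] w il; first by rewrite stuffle_nil_r mem_seq1 => /eqP ->.
have [a0 ik'] := andP ik; have [b0 il'] := andP il.
rewrite stuffle_cons !mem_cat => /or3P[] /mapP[w' hw' ->]; apply/andP; split => //.
- exact: IHk hw'.
- exact: IHl hw'.
- by rewrite addn_gt0 a0.
- exact: IHk hw'.
Qed.

Lemma har_reg_exists (T : RR) : exists Z, is_har_reg T Z.
Proof.
have /choice [p hp] k : exists p : {poly RR}, is_index k -> expansion (hs 0 k 0) p.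
  case: (boolP (is_index k)) => [/(hs_expansion RR) [p hp]|_]; first by exists p.
  by exists 0.
exists (fun k => (p k).[T]); split.
- by rewrite (expansion_inj (hp [::] isT) (expansion_cst 1)) hornerC.
- by rewrite (expansion_inj (hp [:: 1%N] isT) (@expansion_H RR)) hornerX.
- move=> k hk; have ik : is_index k by case/andP: hk.
  rewrite (expansion_inj (hp k ik) (@admissible_expansion RR k hk)) hornerC.
  by congr (limn _); apply/funext => N; rewrite zetaN_hs.
- move=> k l ik il; rewrite -horner_sum -hornerM; congr (_.[_]).
  apply: (expansion_inj (u := fun N => hs 0 k 0 N * hs 0 l 0 N)).
    by apply: expansionM; exact: hp.
  under eq_fun do rewrite hs_stuffle.
  by apply: expansion_sum => w hw; apply: hp; exact: is_index_stuffle hw.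
Qed.

Lemma inZ0 : inZ 0.
Proof. by rewrite -(rmorph0 (@ratr RR)); exact: inZ_rat. Qed.

(** Existence makes the [epsilon] choice satisfy [is_har_reg]. At T = 0 the value of the index (1)
    is 0, so the generators all lie in [inZ]. *)
Lemma inZ_zeta_har k : is_index k -> inZ (zeta_har 0 k).
Proof.
have [_ hT hadm hst] : is_har_reg 0 (zeta_har 0) :=
  epsilon_spec _ _ (har_reg_exists 0).
apply: (@stuffle_generated RR unit (fun k _ => zeta_har 0 k) (fun u => inZ (u tt))).
- by move=> u v; exact: inZ_add.
- by move=> u v; exact: inZ_mul.
- by move=> q u; apply: inZ_mul; exact: inZ_rat.
- by move=> w hw; rewrite hadm //; exact: inZ_zeta.
- by rewrite hT; exact: inZ0.
- by move=> w _ iw; exact: hst.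
Qed.

(** * Index shifts as divided powers of a derivation *)

Lemma compsS d m :
  comps d.+1 m = flatten [seq [seq j :: c | c <- comps d (m - j)] | j <- iota 0 m.+1].
Proof. by []. Qed.

Lemma mem_comps c d m : c \in comps d m -> size c = d /\ sumn c = m.
Proof.
elim: d c m => [|d IH] c m.
  by rewrite /=; case: eqP => // ->; rewrite mem_seq1 => /eqP ->.
rewrite compsS => /flatten_mapP[j]; rewrite mem_iota => /andP[_ hj] /mapP[c' /IH[e1 e2] ->].
by rewrite /= e1 e2; split => //; lia.
Qed.

Lemma size_addseq k c : size c = size k -> size (addseq k c) = size k.
Proof. by move=> e; rewrite size_map size_zip e minnn. Qed.

Lemma wt_addseq k c : size c = size k -> wt (addseq k c) = (wt k + sumn c)%N.
Proof.
rewrite /wt; elim: k c => [|a k IH] [|j c] //= [e].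
by rewrite -/(addseq k c) IH //; lia.
Qed.

Lemma is_index_addseq k c : size c = size k -> is_index k -> is_index (addseq k c).
Proof.
elim: k c => [|a k IH] [|j c] //= [e] /andP[a0 ik].
by apply/andP; split; [rewrite addn_gt0 a0|exact: IH].
Qed.

Lemma sum_triangle (V : nmodType) (G : nat -> nat -> V) m :
  \sum_(0 <= i < m.+1) \sum_(0 <= j < (m - i).+1) G i j
  = \sum_(0 <= j < m.+1) \sum_(0 <= i < j.+1) G i (j - i)%N.
Proof.
elim: m => [|m IH]; first by rewrite !big_nat1 subnn.
rewrite [RHS]big_nat_recr //= -IH big_nat_recr //= subnn big_nat1.
rewrite (eq_big_nat _ _ (F2 := fun i =>
  \sum_(0 <= j < (m - i).+1) G i j + G i (m.+1 - i)%N)); last first.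
  by move=> i /andP[_ hi]; rewrite subSn // big_nat_recr.
rewrite big_split /= -addrA; congr (_ + _).
by rewrite [RHS]big_nat_recr //= subnn.
Qed.

Section ShiftSum.
Variable R : comNzRingType.
Implicit Types (f g : seq nat -> R).

Definition shiftsum f k m : R :=
  \sum_(n <- comps (size k) m) (bcoef k n)%:R * f (addseq k n).

Lemma eq_shiftsum f g k m :
  (forall l, size l = size k -> wt l = (wt k + m)%N -> f l = g l) ->
  shiftsum f k m = shiftsum g k m.
Proof.
move=> e; apply: eq_big_seq => c /mem_comps[e1 e2]; congr (_ * _); apply: e.
  exact: size_addseq.
by rewrite wt_addseq // e2.
Qed.

Lemma shiftsum_mull f x k m :
  shiftsum (fun l => x * f l) k m = x * shiftsum f k m.
Proof. by rewrite mulr_sumr; apply: eq_bigr => c _; rewrite mulrCA. Qed.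

Lemma shiftsum_mulr f x k m :
  shiftsum (fun l => f l * x) k m = shiftsum f k m * x.
Proof. by rewrite mulr_suml; apply: eq_bigr => c _; rewrite mulrA. Qed.

Lemma shiftsumD f g k m :
  shiftsum (fun l => f l + g l) k m = shiftsum f k m + shiftsum g k m.
Proof. by rewrite -big_split; apply: eq_bigr => c _; rewrite mulrDr. Qed.

Lemma shiftsum_sum J (r : seq J) P (G : J -> seq nat -> R) k m :
  shiftsum (fun l => \sum_(i <- r | P i) G i l) k m
  = \sum_(i <- r | P i) shiftsum (G i) k m.
Proof.
by rewrite exchange_big; apply: eq_bigr => c _; rewrite mulr_sumr.
Qed.

Lemma shiftsum_nil f m : shiftsum f [::] m = if m == 0%N then f [::] else 0.
Proof.
rewrite /shiftsum /=; case: eqP => _; last by rewrite big_nil.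
by rewrite big_seq1 /bcoef big_nil mul1r.
Qed.

Lemma shiftsum_cons f a k m :
  shiftsum f (a :: k) m = \sum_(0 <= j < m.+1)
    'C(a + j - 1, j)%:R * shiftsum (fun l => f ((a + j)%N :: l)) k (m - j).
Proof.
rewrite /shiftsum compsS big_flatten big_map /index_iota subn0.
apply: eq_bigr => j _; rewrite big_map mulr_sumr; apply: eq_bigr => c _.
by rewrite /bcoef /= big_cons natrM mulrA.
Qed.

Lemma shiftsum0 f k : shiftsum f k 0 = f k.
Proof.
elim: k f => [|a k IH] f; first by rewrite shiftsum_nil.
by rewrite shiftsum_cons big_nat1 bin0 mul1r IH addn0.
Qed.

(* Since [(j+1) C(a+j,j+1) = (a+j) C(a+j-1,j)], the sums [shiftsum f k m] are the
   divided powers of this derivation. *)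
Fixpoint shift_deriv f k : R :=
  if k is a :: k' then a%:R * f (a.+1 :: k') + shift_deriv (fun l => f (a :: l)) k'
  else 0.

Lemma eq_shift_deriv f g k : f =1 g -> shift_deriv f k = shift_deriv g k.
Proof.
move=> e; elim: k f g e => //= a k IH f g e; rewrite e; congr (_ + _).
by apply: IH => l.
Qed.

Lemma eq_iter_shift_deriv f g k m : f =1 g ->
  iter m shift_deriv f k = iter m shift_deriv g k.
Proof. by move=> e; elim: m k => //= m IH k; apply: eq_shift_deriv. Qed.

Lemma shiftsum_succ f k m :
  m.+1%:R * shiftsum f k m.+1 = shiftsum (shift_deriv f) k m.
Proof.
elim: k f m => [|a k IH] f m.
  by rewrite !shiftsum_nil mulr0 /=; case: ifP.
rewrite !shiftsum_cons mulr_sumr.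
(* The factor m + 1 is split as j + (m + 1 - j): the first part acts on the head through the
   binomial absorption identity, the second on the tail through the induction hypothesis. *)
rewrite (eq_big_nat _ _ (F2 := fun j =>
    (j * 'C(a + j - 1, j))%:R * shiftsum (fun l => f ((a + j)%N :: l)) k (m.+1 - j)
  + 'C(a + j - 1, j)%:R *
    ((m.+1 - j)%:R * shiftsum (fun l => f ((a + j)%N :: l)) k (m.+1 - j)))); last first.
  move=> j /andP[_ hj]; rewrite -{1}(subnKC (_ : j <= m.+1)%N); last by lia.
  by rewrite natrD natrM; ring.
rewrite (eq_big_nat _ _ (F1 := fun j => 'C(a + j - 1, j)%:R * _) (F2 := fun j =>
    ('C(a + j - 1, j) * (a + j))%:R
      * shiftsum (fun l => f ((a + j).+1 :: l)) k (m - j)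
  + 'C(a + j - 1, j)%:R *
    ((m.+1 - j)%:R * shiftsum (fun l => f ((a + j)%N :: l)) k (m.+1 - j)))); last first.
  move=> j /andP[_ hj]; rewrite shiftsumD shiftsum_mull mulrDr natrM mulrA.
  by rewrite subSn // IH.
rewrite !big_split /=; congr (_ + _).
  rewrite big_nat_recl // mul0n mul0r add0r; apply: eq_bigr => j _.
  rewrite addnS !subSS subn0 -mul_bin_diag subn1 mulnC.
  by [].
by rewrite big_nat_recr //= subnn mul0r mulr0 addr0.
Qed.

Lemma fact_shiftsum f k m : (m`!)%:R * shiftsum f k m = iter m shift_deriv f k.
Proof.
elim: m f => [|m IH] f.
  by rewrite mul1r shiftsum0.
by rewrite iterSr -IH -shiftsum_succ mulrA -natrM factS mulnC.
Qed.

(** Leibniz rule for concatenation: the total shift m is distributed over the two blocks, and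
    [bcoef] is multiplicative. *)
Lemma shiftsum_split f k1 k2 m :
  shiftsum f (k1 ++ k2) m = \sum_(0 <= i < m.+1)
    shiftsum (fun l1 => shiftsum (fun l2 => f (l1 ++ l2)) k2 (m - i)) k1 i.
Proof.
elim: k1 f m => [|a k1 IH] f m.
  rewrite big_nat_recl // shiftsum_nil subn0 big1 ?addr0 // => i _.
  by rewrite shiftsum_nil.
rewrite cat_cons shiftsum_cons.
under eq_bigr do rewrite IH mulr_sumr.
rewrite (sum_triangle (fun i j => 'C(a + i - 1, i)%:R * shiftsum (fun l1 =>
  shiftsum (fun l2 => f ((a + i)%N :: l1 ++ l2)) k2 (m - i - j)) k1 j)).
apply: eq_big_nat => j /andP[_ hj]; rewrite shiftsum_cons.
apply: eq_big_nat => i /andP[_ hi]; congr (_ * _).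
by apply: eq_shiftsum => l _ _; congr (shiftsum _ _ _); lia.
Qed.

Lemma shiftsum_rev f k m :
  shiftsum f (rev k) m = shiftsum (fun l => f (rev l)) k m.
Proof.
elim: k f m => [|a k IH] f m; first by rewrite !shiftsum_nil.
rewrite rev_cons -cats1 shiftsum_split shiftsum_cons big_nat_rev /= add0n.
apply: eq_big_nat => j /andP[_ hj].
have -> : (m.+1 - j.+1)%N = (m - j)%N by lia.
rewrite IH -shiftsum_mull; apply: eq_shiftsum => l _ _.
rewrite (_ : (m - (m - j))%N = j); last by lia.
rewrite shiftsum_cons big_nat_recr //= big_nat big1 ?add0r => [|i /andP[_ hi]].
  by rewrite shiftsum_nil subnn rev_cons -cats1.
by rewrite shiftsum_nil subn_eq0 leqNgt hi mulr0.
Qed.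

End ShiftSum.

(** After multiplication by m! n!, both sides are the (m+n)-th iterate of [shift_deriv];
    characteristic 0 allows the factorials to be cancelled. *)
Lemma shiftsum_shiftsum (R : numDomainType) (f : seq nat -> R) k m n :
  shiftsum (fun l => shiftsum f l n) k m = 'C(m + n, m)%:R * shiftsum f k (m + n).
Proof.
have h p : (p`!)%:R != 0 :> R by rewrite pnatr_eq0 -lt0n fact_gt0.
apply: (mulfI (h m)); apply: (mulfI (h n)).
rewrite [RHS](_ : _ = ('C(m + n, m) * (m`! * n`!))%:R * shiftsum f k (m + n));
  last by rewrite !natrM; ring.
have -> : ('C(m + n, m) * (m`! * n`!) = (m + n)`!)%N.
  by have := bin_fact (leq_addr n m); rewrite addKn.
rewrite mulrCA -(shiftsum_mull _ n`!%:R k m) !fact_shiftsum iterD.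
by apply: eq_iter_shift_deriv => l; exact: fact_shiftsum.
Qed.

(* Formal version of the expansion of [(x + at)^-k] in powers of [at]: the
   variable [s] of the first factor becomes [a] and the second becomes [a + 1]
   by the binomial theorem. *)
Lemma shiftsum_symmetric (R : numDomainType) (f : seq nat -> R) (a : R) k n :
  let sym l i j := \sum_(r < (size l).+1) (-1) ^+ wt (drop r l)
    * ((-1) ^+ i * shiftsum f (take r l) i) * shiftsum f (rev (drop r l)) j in
  \sum_(0 <= i < n.+1) sym k i (n - i)%N * a ^+ i * (a + 1) ^+ (n - i)
  = \sum_(0 <= m < n.+1) (- a) ^+ m * shiftsum (fun l => sym l 0%N (n - m)%N) k m.
Proof.
move=> sym.
(* At each cut [r] the Leibniz rule gives shift i to the first block and m - i to the second, where
   it composes with the shift n - m already present. The weight of the second block grows by m - i,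
   hence the sign. *)
have symE m : shiftsum (fun l => sym l 0%N (n - m)%N) k m
    = \sum_(r < (size k).+1) \sum_(0 <= i < m.+1)
       shiftsum f (take r k) i * ((-1) ^+ (wt (drop r k) + (m - i))
         * ('C(m - i + (n - m), m - i)%:R
            * shiftsum f (rev (drop r k)) (m - i + (n - m)))).
  rewrite (eq_shiftsum (g := fun l => \sum_(r < (size k).+1)
    (-1) ^+ wt (drop r l) * f (take r l) * shiftsum f (rev (drop r l)) (n - m))).
    rewrite shiftsum_sum; apply: eq_bigr => -[r hr] _ /=.
    rewrite -{1}(cat_take_drop r k) shiftsum_split; apply: eq_bigr => i _.
    rewrite -shiftsum_mulr; apply: eq_shiftsum => l1 e1 _.
    have er : size l1 = r by rewrite e1 size_takel.
    rewrite shiftsum_rev -shiftsum_shiftsum -!shiftsum_mull.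
    apply: eq_shiftsum => l2 _ e2.
    by rewrite drop_size_cat // take_size_cat // -e2 shiftsum_rev; ring.
  move=> l e _; rewrite /sym e; apply: eq_bigr => r _.
  rewrite mul1r; congr (_ * _ * _).
  exact: shiftsum0.
under [RHS]eq_bigr do rewrite symE mulr_sumr.
rewrite [RHS]exchange_big /= /sym.
under eq_bigr do rewrite !mulr_suml.
rewrite exchange_big; apply: eq_bigr => r _.
set S1 := shiftsum f (take r k); set S2 := shiftsum f _.
(* For a fixed cut, the powers of a + 1 are expanded binomially; the triangle is then summed along
   diagonals. *)
transitivity (\sum_(0 <= i < n.+1) \sum_(0 <= m < (n - i).+1)
  (-1) ^+ wt (drop r k) * ((- a) ^+ i * S1 i * (a ^+ m *+ 'C(n - i, m) * S2 (n - i)%N))).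
  apply: eq_bigr => i _; rewrite -!mulr_sumr -mulr_suml.
  rewrite [in (a + 1) ^+ _]addrC exprDn.
  rewrite -(big_mkord xpredT (fun m => 1 ^+ (n - i - m) * a ^+ m *+ 'C(n - i, m))).
  under eq_bigr do rewrite expr1n mul1r.
  by rewrite [(- a) ^+ i]exprNn; ring.
rewrite (sum_triangle (fun i m => (-1) ^+ wt (drop r k)
  * ((- a) ^+ i * S1 i * (a ^+ m *+ 'C(n - i, m) * S2 (n - i)%N)))).
apply: eq_big_nat => m /andP[_ hm]; rewrite mulr_sumr.
apply: eq_big_nat => i /andP[_ hi].
have -> : (m - i + (n - m) = n - i)%N by lia.
have -> : (- a) ^+ m = (- a) ^+ i * ((-1) ^+ (m - i) * a ^+ (m - i)).
  by rewrite -exprNn -exprD subnKC.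
rewrite exprD -[in LHS]mulr_natr.
(* This sign occurs twice, once from [(- a) ^+ m] and once from the weight, and cancels. *)
have : (-1) ^+ (m - i) * (-1) ^+ (m - i) = 1 :> R by rewrite -expr2 sqrr_sign.
move: ((-1) ^+ (m - i)) => e ee.
transitivity (e * e * ((-1) ^+ wt (drop r k) * ((- a) ^+ i * S1 i
  * (a ^+ (m - i) * 'C(n - i, m - i)%:R * S2 (n - i)%N)))); last by ring.
by rewrite ee mul1r.
Qed.

(** * p-adic expansions *)

Section PIntegral.
Variable p : nat.
Hypothesis p_pr : prime p.
Local Notation pint := (p_integral p).

(** Allowing a denominator that is not in lowest terms makes closure under sums and products
    immediate. *)
Lemma p_integralP x :
  reflect (exists (d : nat) (n : int), coprime d p /\ x * d%:R = n%:~R) (pint x).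
Proof.
apply: (iffP idP) => [h|[d [n [cd e]]]].
  exists `|denq x|%N, (numq x); split => //.
  by rewrite numqE -[in RHS](gez0_abs (denq_ge0 x)).
rewrite /p_integral; apply: coprime_dvdl cd.
have e' : numq x * d%:Z = n * denq x.
  apply: (intr_inj (R := rat)); rewrite !rmorphM /= numqE -e -pmulrn; ring.
have : (`|denq x| %| `|numq x| * d)%N.
  by rewrite -[d]/(`|d%:Z|)%N -abszM e' abszM dvdn_mull.
by rewrite Gauss_dvdr // coprime_sym coprime_num_den.
Qed.

Lemma p_integral_int (z : int) : pint z%:~R.
Proof. by apply/p_integralP; exists 1%N, z; rewrite coprime1n mulr1. Qed.

Lemma p_integral_nat (n : nat) : pint n%:R.
Proof. exact: (p_integral_int n). Qed.

Lemma p_integral0 : pint 0. Proof. exact: (p_integral_int 0). Qed.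
Lemma p_integral1 : pint 1. Proof. exact: (p_integral_int 1). Qed.

Lemma p_integralM x y : pint x -> pint y -> pint (x * y).
Proof.
move=> /p_integralP[d [n [cd ed]]] /p_integralP[e [m [ce ee]]].
apply/p_integralP; exists (d * e)%N, (n * m); rewrite coprimeMl cd ce; split => //.
by rewrite natrM rmorphM /= -ed -ee; ring.
Qed.

Lemma p_integralD x y : pint x -> pint y -> pint (x + y).
Proof.
move=> /p_integralP[d [n [cd ed]]] /p_integralP[e [m [ce ee]]].
apply/p_integralP; exists (d * e)%N, (n * e%:Z + m * d%:Z).
rewrite coprimeMl cd ce; split => //.
by rewrite natrM rmorphD !rmorphM /= -ed -ee -!pmulrn; ring.
Qed.

Lemma p_integralN x : pint x -> pint (- x).
Proof. by rewrite -mulN1r; apply: p_integralM; exact: (p_integral_int (-1)). Qed.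

Lemma p_integralX x n : pint x -> pint (x ^+ n).
Proof.
move=> hx; elim: n => [|n IH]; first exact: p_integral1.
by rewrite exprS; exact: p_integralM.
Qed.

Lemma p_integral_sum (I : eqType) (r : seq I) (F : I -> rat) :
  (forall i, i \in r -> pint (F i)) -> pint (\sum_(i <- r) F i).
Proof.
move=> h; rewrite big_seq; elim/big_ind: _ => //; [exact: p_integral0|exact: p_integralD].
Qed.

Lemma p_integral_inv (z : int) : coprime `|z| p -> pint (z%:~R)^-1.
Proof.
move=> cz; apply/p_integralP; exists `|z|%N, (sgz z); split => //.
have z0 : z != 0.
  by apply: contraTneq cz => ->; rewrite /coprime gcd0n; case: eqP p_pr => // ->.
have z0' : z%:~R != 0 :> rat by rewrite intr_eq0.
apply: (mulfI z0'); rewrite mulrA divff // mul1r -rmorphM /=.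
by have -> : z * sgz z = `|z|%N by case: sgzP => h; lia.
Qed.

Lemma congr_refl n x : congr_pn p n x x.
Proof. by rewrite /congr_pn subrr mul0r p_integral0. Qed.

Lemma congr_sym n x y : congr_pn p n x y -> congr_pn p n y x.
Proof. by move=> /p_integralN; rewrite -mulNr opprB. Qed.

Lemma congr_trans n y x z :
  congr_pn p n x y -> congr_pn p n y z -> congr_pn p n x z.
Proof. by move=> hx hy; have := p_integralD hx hy; rewrite -mulrDl addrA subrK. Qed.

Lemma congrD n x y x' y' :
  congr_pn p n x y -> congr_pn p n x' y' -> congr_pn p n (x + x') (y + y').
Proof.
move=> hx hy; have := p_integralD hx hy; rewrite -mulrDl.
by rewrite addrACA -opprD.
Qed.

Lemma congrMl n z x y : pint z -> congr_pn p n x y -> congr_pn p n (z * x) (z * y).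
Proof. by move=> hz hx; have := p_integralM hz hx; rewrite mulrA mulrBr. Qed.

Lemma congrM n x y x' y' : pint x' -> pint y ->
  congr_pn p n x y -> congr_pn p n x' y' -> congr_pn p n (x * x') (y * y').
Proof.
move=> hx' hy h h'; apply: (congr_trans (y := y * x')); last exact: congrMl.
by rewrite ![_ * x']mulrC; exact: congrMl.
Qed.

Lemma congr_sum n (I : eqType) (r : seq I) (F G : I -> rat) :
  (forall i, i \in r -> congr_pn p n (F i) (G i)) ->
  congr_pn p n (\sum_(i <- r) F i) (\sum_(i <- r) G i).
Proof.
move=> h; rewrite /congr_pn -sumrB mulr_suml; exact: p_integral_sum.
Qed.

Lemma pexp_neq0 n : (p ^ n)%:R != 0 :> rat.
Proof. by rewrite pnatr_eq0 -lt0n expn_gt0 prime_gt0. Qed.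

Lemma congr_integral n x y : congr_pn p n x y -> pint y -> pint x.
Proof.
move=> h hy; have := p_integralD (p_integralM h (p_integral_nat (p ^ n))) hy.
by rewrite mulfVK ?pexp_neq0 // subrK.
Qed.

(** * Power series in a multiple of p *)

Variable y : rat.
Hypothesis y_div : pint (y / p%:R).

Lemma p_integral_y : pint y.
Proof.
have := p_integralM y_div (p_integral_nat p).
by rewrite mulfVK // pnatr_eq0 -lt0n prime_gt0.
Qed.

Lemma p_integral_expr_div n m : (n <= m)%N -> pint (y ^+ m / (p ^ n)%:R).
Proof.
move=> /subnKC <-; rewrite exprD natrX mulrAC -expr_div_n.
by apply: p_integralM; apply: p_integralX; rewrite ?p_integral_y.
Qed.

(** A p-adically convergent expansion of [u] in powers of [y], phrased within the rationals: since p
    divides [y], M terms determine [u] modulo p^M. *)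
Definition padic_series (u : rat) (c : nat -> rat) : Prop :=
  (forall j, pint (c j)) /\
  forall M, congr_pn p M u (\sum_(0 <= j < M) c j * y ^+ j).

Lemma eq_padic_series u c d : c =1 d -> padic_series u c -> padic_series u d.
Proof.
move=> e [ic hc]; split => [j|M]; first by rewrite -e.
by under eq_bigr do rewrite -e.
Qed.

Lemma padic_series_integral u c : padic_series u c -> pint u.
Proof.
by move=> [_ /(_ 0%N)]; rewrite big_geq // /congr_pn subr0 divr1.
Qed.

Lemma padic_series1 : padic_series 1 (fun m => (m == 0%N)%:R).
Proof.
split => [j|[|M]]; first exact: p_integral_nat.
  by rewrite big_geq // /congr_pn subr0 divr1 p_integral1.
rewrite big_nat_recl // big1 ?addr0 ?mulr1; first exact: congr_refl.
by move=> i _; rewrite mul0r.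
Qed.

Lemma padic_series_sum (r : seq nat) (u : nat -> rat) (c : nat -> nat -> rat) :
  (forall i, i \in r -> padic_series (u i) (c i)) ->
  padic_series (\sum_(i <- r) u i) (fun m => \sum_(i <- r) c i m).
Proof.
move=> h; split => [j|M]; first by apply: p_integral_sum => i /h [].
under [X in congr_pn _ _ _ X]eq_bigr do rewrite mulr_suml.
by rewrite exchange_big; apply: congr_sum => i /h [_]; exact.
Qed.

Lemma padic_seriesM u v c d : padic_series u c -> padic_series v d ->
  padic_series (u * v) (fun m => \sum_(0 <= i < m.+1) c i * d (m - i)%N).
Proof.
move=> hu hv; have iv := padic_series_integral hv; have iu := padic_series_integral hu.
case: hu hv => [ic hu] [id hv]; split => [j|[|M]].
- by apply: p_integral_sum => i _; exact: p_integralM.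
- by rewrite big_geq // /congr_pn subr0 divr1; exact: p_integralM.
have iU : pint (\sum_(0 <= j < M.+1) c j * y ^+ j).
  by apply: p_integral_sum => j _; apply: p_integralM => //; exact: p_integralX p_integral_y.
apply: congr_trans (congrM iv iU (hu M.+1) (hv M.+1)) _.
pose G i j := c i * d j * y ^+ (i + j).
have -> : \sum_(0 <= m < M.+1) (\sum_(0 <= i < m.+1) c i * d (m - i)%N) * y ^+ m
    = \sum_(0 <= i < M.+1) \sum_(0 <= j < (M - i).+1) G i j.
  rewrite sum_triangle; apply: eq_bigr => m _; rewrite mulr_suml.
  by apply: eq_big_nat => i /andP[_ hi]; rewrite /G subnKC.
rewrite mulr_suml; apply: congr_sum => i; rewrite mem_index_iota => /andP[_ hi].
(* The terms beyond the triangle have i + j > M, so their power of [y] is divisible by p^(M+1). *)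
rewrite mulr_sumr (@big_cat_nat _ _ _ (M - i).+1) //=; last by lia.
rewrite -[X in congr_pn _ _ _ X]addr0; apply: congrD.
  by apply: congr_sum => j _; rewrite /G exprD mulrACA; exact: congr_refl.
rewrite /congr_pn subr0 mulr_suml; apply: p_integral_sum => j.
rewrite mem_index_iota => /andP[hj _]; rewrite mulrACA -exprD.
rewrite -[X in pint X]mulrA; apply: p_integralM; last by apply: p_integral_expr_div; lia.
exact: p_integralM.
Qed.

(** Geometric series: the remainder after M terms is exactly (-y/z)^M / (y+z), which is divisible by
    p^M. *)
Lemma padic_series_inv (z : rat) : pint z^-1 -> pint (y + z)^-1 ->
  z != 0 -> y + z != 0 ->
  padic_series (y + z)^-1 (fun j => (-1) ^+ j * z ^- j.+1).
Proof.
move=> iz iyz z0 yz0; split => [j|M].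
  by rewrite -exprVn; apply: p_integralM; apply: p_integralX => //; exact: (p_integral_int (-1)).
have -> : \sum_(0 <= j < M) (-1) ^+ j * z ^- j.+1 * y ^+ j
    = (y + z)^-1 - (-1) ^+ M * y ^+ M * z ^- M * (y + z)^-1.
  elim: M => [|M IH]; first by rewrite big_geq // !expr0 invr1 !mul1r subrr.
  rewrite big_nat_recr //= IH !exprS !invfM -!exprVn.
  move: (z^-1 ^+ M) (y ^+ M) ((-1) ^+ M) => A B C.
  by field; apply/andP.
rewrite /congr_pn opprB addrC subrK -!exprVn.
rewrite [X in p_integral p X](_ : _ = (-1) ^+ M * z^-1 ^+ M * (y + z)^-1
    * (y ^+ M / (p ^ M)%:R)); last by ring.
apply: p_integralM; last exact: p_integral_expr_div.
apply: p_integralM => //; apply: p_integralM; apply: p_integralX => //.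
exact: (p_integral_int (-1)).
Qed.

Lemma sum_bin_hockey a m :
  (\sum_(0 <= j < m.+1) 'C(a + j - 1, j) = 'C(a + m, m))%N.
Proof.
elim: m => [|m IH]; first by rewrite big_nat1 !bin0.
by rewrite big_nat_recr //= IH addnS subn1 /= binS addnC.
Qed.

(** Repeated multiplication by the geometric series; the hockey-stick identity sums the binomials.
    These are the factors of [bcoef]. *)
Lemma padic_series_invX (z : rat) a : pint z^-1 -> pint (y + z)^-1 ->
  z != 0 -> y + z != 0 ->
  padic_series ((y + z) ^- a)
    (fun j => (-1) ^+ j * 'C(a + j - 1, j)%:R * z ^- (a + j)).
Proof.
move=> iz iyz z0 yz0; elim: a => [|a IH].
  rewrite expr0 invr1; apply: eq_padic_series padic_series1 => -[|j].
    by rewrite bin0 !expr0 invr1 !mulr1.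
  by rewrite add0n bin_small ?mulr0 ?mul0r //; lia.
rewrite exprS invfM; apply: eq_padic_series (padic_seriesM (padic_series_inv iz iyz z0 yz0) IH).
move=> m; rewrite [(a.+1 + m)%N]addSn subSS subn0 -sum_bin_hockey.
rewrite natr_sum mulr_sumr mulr_suml big_nat_rev /=.
apply: eq_big_nat => i /andP[_ hi]; rewrite add0n.
have -> : (m.+1 - i.+1 = m - i)%N by lia.
rewrite subKn // -!exprVn.
have -> : z^-1 ^+ (a + m).+1 = z^-1 ^+ (m - i).+1 * z^-1 ^+ (a + i).
  by rewrite -exprD; congr (_ ^+ _); lia.
have -> : (-1) ^+ m = (-1) ^+ (m - i) * (-1) ^+ i :> rat.
  by rewrite -exprD; congr (_ ^+ _); lia.
by ring.
Qed.

End PIntegral.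

Lemma padic_series_hs (p : nat) (a : int) k x : prime p ->
  padic_series p (a * p%:Z)%:~R (hs (a * p%:Z)%:~R k x p)
    (fun m => (-1) ^+ m * shiftsum (fun l => hs 0 l x p) k m).
Proof.
move=> pp; set y := _%:~R.
have hy : p_integral p (y / p%:R).
  rewrite /y rmorphM /= mulfK ?p_integral_int //.
  by rewrite intr_eq0 -lt0n prime_gt0.
elim: k x => [|b k IH] x.
  apply: (eq_padic_series _ (padic_series1 p y)) => -[|m].
    by rewrite shiftsum0 mul1r.
  by rewrite shiftsum_nil mulr0.
(* Used with c = a for the shifted denominators and with c = 0 for the denominators n. *)
have hn n : (0 < n < p)%N -> forall c : int,
    coprime (absz (c * p%:Z + n%:Z)) p /\ c * p%:Z + n%:Z != 0.
  move=> /andP[n0 np] c.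
  have nd : ~~ (p%:Z %| c * p%:Z + n%:Z)%Z.
    rewrite rpredDl ?dvdz_mull // dvdzE /= gtnNdvd //.
  split; last by apply: contraNneq nd => ->; rewrite dvdz0.
  by rewrite coprime_sym prime_coprime //; move: nd; rewrite dvdzE.
apply: (eq_padic_series (c := fun m => \sum_(x.+1 <= n < p)
    \sum_(0 <= i < m.+1) ((-1) ^+ i * 'C(b + i - 1, i)%:R * n%:R ^- (b + i))
      * ((-1) ^+ (m - i) * shiftsum (fun l => hs 0 l n p) k (m - i)))); last first.
  apply: padic_series_sum => // n; rewrite mem_index_iota => /andP[xn np].
  have n0p : (0 < n < p)%N by lia.
  have [c1 c2] := hn n n0p a; have [d1 d2] := hn n n0p 0.
  rewrite mul0r add0r in d1 d2.
  apply: (padic_seriesM pp hy _ (IH n)); apply: (padic_series_invX pp hy).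
  - exact: (p_integral_inv pp d1).
  - by have := p_integral_inv pp c1; rewrite rmorphD.
  - by move: d2; rewrite -(intr_eq0 rat).
  - by move: c2; rewrite -(intr_eq0 rat) rmorphD.
move=> m; rewrite shiftsum_cons exchange_big mulr_sumr /=.
apply: eq_big_nat => i /andP[_ hi].
rewrite (eq_shiftsum (g := fun l => \sum_(x.+1 <= n < p) n%:R ^- (b + i) * hs 0 l n p)).
  rewrite shiftsum_sum !mulr_sumr; apply: eq_bigr => n _; rewrite shiftsum_mull.
  have -> : (-1) ^+ m = (-1) ^+ (m - i) * (-1) ^+ i :> rat.
    by rewrite -exprD; congr (_ ^+ _); lia.
  by ring.
by move=> l _ _ /=; apply: eq_bigr => n _; rewrite add0r.
Qed.

Lemma zetaA_expansion (p : nat) (a : int) k M n : prime p ->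
  congr_pn p M (zetaA k a n p) (\sum_(0 <= m < M)
    (- (a * p%:Z)%:~R) ^+ m * shiftsum (fun l => zetaA l 0 n p) k m).
Proof.
move=> pp; have [_ /(_ M)] := padic_series_hs a k 0 pp.
have -> : zetaA k a n p = hs (a * p%:Z)%:~R k 0 p.
  by rewrite /zetaA -hsumE addr0 mulrDl mul1r.
rewrite [X in congr_pn _ _ _ X -> _](_ : _ = \sum_(0 <= m < M)
    (- (a * p%:Z)%:~R) ^+ m * shiftsum (fun l => zetaA l 0 n p) k m) //.
apply: eq_bigr => m _; rewrite mulrAC -exprMn mulN1r; congr (_ * _).
apply: eq_shiftsum => l _ _.
by rewrite /zetaA mul0r add0r mul1r -(hsumE 0) !add0r.
Qed.

(** * Membership and uniqueness *)

(** At distinct rational nodes the Vandermonde matrix is invertible over the rationals, so each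
    coefficient is a rational combination of the values. *)
Lemma vandermonde_subspace (W : RR -> Prop) (q : nat -> rat) (D : nat -> RR) n :
  W 0 -> (forall x y, W x -> W y -> W (x + y)) -> (forall c x, W x -> W (ratr c * x)) ->
  injective q ->
  (forall j : nat, W (\sum_(0 <= i < n) D i * ratr (q j) ^+ i)) ->
  forall i, (i < n)%N -> W (D i).
Proof.
move=> W0 WD WZ qi h i0 hi.
pose V : 'M[rat]_n := Vandermonde n (\row_(j < n) q j).
have uV : V \in unitmx.
  rewrite unitmxE det_Vandermonde unitfE; apply/prodf_neq0 => i _.
  apply/prodf_neq0 => j hij; rewrite !mxE subr_eq0; apply: contraTneq hij => /qi ->.
  by rewrite ltnn.
pose i1 := Ordinal hi.
have -> : D i0 = \sum_(j < n) ratr (invmx V j i1) * (\sum_(0 <= i < n) D i * ratr (q j) ^+ i).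
  under eq_bigr do rewrite mulr_sumr big_mkord.
  rewrite exchange_big /= (bigD1 i1) //= [X in _ + X]big1 ?addr0 => [|i hne].
    transitivity (D i0 * ratr ((V *m invmx V) i1 i1)).
      by rewrite mulmxV // mxE eqxx rmorph1 mulr1.
    rewrite mxE rmorph_sum mulr_sumr; apply: eq_bigr => j _.
    by rewrite rmorphM /= !mxE rmorphXn /=; ring.
  transitivity (D i * ratr ((V *m invmx V) i i1)).
    rewrite mxE rmorph_sum mulr_sumr; apply: eq_bigr => j _.
    by rewrite rmorphM /= !mxE rmorphXn /=; ring.
  by rewrite mulmxV // mxE (negPf hne) rmorph0 mulr0.
by elim/big_ind: _ => // j _; apply: WZ.
Qed.

(** * Coefficients in the algebra of multiple zeta values *)

Lemma inZ1 : inZ 1.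
Proof. by rewrite -(rmorph1 (@ratr RR)); exact: inZ_rat. Qed.

Lemma inZ_nat n : inZ n%:R.
Proof. by rewrite -(ratr_nat RR); exact: inZ_rat. Qed.

Lemma inZ_int (z : int) : inZ z%:~R.
Proof. by rewrite -(ratr_int RR); exact: inZ_rat. Qed.

Lemma inZX x n : inZ x -> inZ (x ^+ n).
Proof.
by move=> hx; elim: n => [|n IH]; [exact: inZ1|rewrite exprS; exact: inZ_mul].
Qed.

Lemma inZB x y : inZ x -> inZ y -> inZ (x - y).
Proof.
move=> hx hy; apply: inZ_add => //; rewrite -mulN1r; apply: inZ_mul => //.
exact: (inZ_int (-1)).
Qed.

Lemma inZ_sum (I : eqType) (r : seq I) (F : I -> RR) :
  (forall i, i \in r -> inZ (F i)) -> inZ (\sum_(i <- r) F i).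
Proof.
by move=> h; rewrite big_seq; elim/big_ind: _ => //; [exact: inZ0|exact: inZ_add].
Qed.

Lemma shift_coefE sg T k m :
  shift_coef sg T k m = shiftsum (zeta_har T) k m * (- sg) ^+ m.
Proof. by rewrite mulr_suml. Qed.

Lemma inZ_shiftsum f k m :
  (forall l, is_index l -> inZ (f l)) -> is_index k -> inZ (shiftsum f k m).
Proof.
move=> hf ik; apply: inZ_sum => c /mem_comps[e _].
by apply: inZ_mul; [exact: inZ_nat|apply: hf; exact: is_index_addseq].
Qed.

Lemma zetaSE k i j : zetaS k i j = \sum_(r < (size k).+1) (-1) ^+ wt (drop r k)
  * ((-1) ^+ i * shiftsum (zeta_har 0) (take r k) i)
  * shiftsum (zeta_har 0) (rev (drop r k)) j.
Proof.
apply: eq_bigr => r _; rewrite !shift_coefE opprK expr1n mulr1.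
by congr (_ * _ * _); rewrite mulrC.
Qed.

Lemma inZ_zetaS k i j : is_index k -> inZ (zetaS k i j).
Proof.
move=> ik; rewrite zetaSE; apply: inZ_sum => r _.
have iX n : inZ ((-1) ^+ n) by apply: inZX; exact: (inZ_int (-1)).
have [it id] : is_index (take r k) /\ is_index (drop r k).
  by move: ik; rewrite -{1}(cat_take_drop r k) is_index_cat => /andP.
apply: inZ_mul; first apply: inZ_mul => //; first apply: inZ_mul => //.
  by apply: inZ_shiftsum => // l; exact: inZ_zeta_har.
by apply: inZ_shiftsum; [exact: inZ_zeta_har|rewrite /is_index all_rev].
Qed.

Lemma subst_stE X a n : subst_st X a n =
  \sum_(0 <= i < n.+1) X i (n - i)%N * a%:~R ^+ i * (a%:~R + 1) ^+ (n - i).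
Proof. by rewrite big_mkord; apply: eq_bigr => i _; rewrite rmorphD. Qed.

Lemma subst_zetaS k a n : subst_st (zetaS k) a n = \sum_(0 <= m < n.+1)
  (- a%:~R) ^+ m * shiftsum (fun l => zetaS0 l (n - m)%N) k m.
Proof.
rewrite subst_stE; under eq_bigr do rewrite zetaSE.
rewrite (shiftsum_symmetric (zeta_har 0)); apply: eq_bigr => m _; congr (_ * _).
by apply: eq_shiftsum => l _ _; rewrite /zetaS0 zetaSE.
Qed.

Lemma inZ_subst_st X a : inZser2 X -> inZser (subst_st X a).
Proof.
move=> hX n; rewrite subst_stE; apply: inZ_sum => i _.
apply: inZ_mul; first by apply: inZ_mul => //; apply: inZX; exact: inZ_int.
by apply: inZX; apply: inZ_add; [exact: inZ_int|exact: inZ1].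
Qed.

Lemma in_z2Z0 : in_z2Z 0.
Proof. by exists 0; split; [exact: inZ0|rewrite mulr0]. Qed.

Lemma in_z2Z_unique (X Y : ser2) :
  (forall a : nat, ser_eq (subst_st X a) (subst_st Y a)) ->
  forall i j, in_z2Z (X i j - Y i j).
Proof.
move=> h i j.
pose D i' := X i' (i + j - i')%N - Y i' (i + j - i')%N.
rewrite (_ : X i j - Y i j = D i); last by rewrite /D addKn.
have WZ (c : rat) x : in_z2Z x -> in_z2Z (ratr c * x).
  move=> [y [hy ->]]; exists (ratr c * y); split; last by rewrite mulrCA.
  by apply: inZ_mul => //; exact: inZ_rat.
(* dividing the homogeneous form by (a + 1)^(i + j) gives a polynomial in
   q = a / (a + 1) *)
pose q (a : nat) : rat := a%:R / a.+1%:R.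
apply: (@vandermonde_subspace in_z2Z q D (i + j).+1) => //.
- exact: in_z2Z0.
- move=> _ _ [x [hx ->]] [y [hy ->]]; exists (x + y); split; last by rewrite mulrDr.
  exact: inZ_add.
- move=> a b /eqP; rewrite /q eqr_div ?pnatr_eq0 // -!natrM eqr_nat => /eqP; lia.
- move=> a; have := h a (i + j)%N; rewrite !subst_stE -sumrB => ha.
  rewrite (_ : \sum_(_ <= _ < _) _ = ratr ((a.+1%:R ^+ (i + j))^-1) * (\sum_(0 <= k < (i + j).+1)
    (X k (i + j - k)%N * a%:~R ^+ k * (a%:~R + 1) ^+ (i + j - k)
     - Y k (i + j - k)%N * a%:~R ^+ k * (a%:~R + 1) ^+ (i + j - k)))); first exact: WZ.
  rewrite mulr_sumr; apply: eq_big_nat => k /andP[_ hk].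
  rewrite fmorphV rmorphXn /= fmorph_div /= !ratr_nat -!pmulrn natr1.
  have n0 : a.+1%:R != 0 :> RR by rewrite pnatr_eq0.
  have -> : a.+1%:R ^+ (i + j) = a.+1%:R ^+ (i + j - k) * a.+1%:R ^+ k :> RR.
    by rewrite -exprD subnK.
  rewrite expr_div_n /D; move: (a.+1%:R ^+ k) (expf_neq0 k n0) => A A0.
  move: (a.+1%:R ^+ (i + j - k)) (expf_neq0 (i + j - k) n0) => B B0.
  by field; apply/andP.
- by rewrite ltnS leq_addr.
Qed.

(** * The period map *)

Lemma ae_primeI (P Q : nat -> Prop) :
  ae_prime P -> ae_prime Q -> ae_prime (fun p => P p /\ Q p).
Proof.
move=> [B hB] [C hC]; exists (maxn B C) => p pp; rewrite geq_max => /andP[h1 h2].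
by split; [exact: hB|exact: hC].
Qed.

Lemma ae_primeW (P Q : nat -> Prop) :
  (forall p, prime p -> P p -> Q p) -> ae_prime P -> ae_prime Q.
Proof. by move=> h [B hB]; exists B => p pp hp; apply: h => //; exact: hB. Qed.

Lemma eqA_trans y x z : eqA x y -> eqA y z -> eqA x z.
Proof.
move=> hx hy n; apply: ae_primeW (ae_primeI (hx n) (hy n)) => p _ [].
exact: congr_trans.
Qed.

Lemma eqA_sym x y : eqA x y -> eqA y x.
Proof. by move=> h n; apply: ae_primeW (h n) => p _; exact: congr_sym. Qed.

Section PerHat.
Variable per : ser -> Arep.
Hypothesis hper : is_per_hat per.

Let per_isA f : inZser f -> isA (per f).
Proof. by move=> hf; have [_ [/(_ f hf) []]] := hper. Qed.

Let per_integral f n : inZser f -> ae_prime (fun p => p_integral p (per f n p)).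
Proof. by move=> /per_isA /(_ n); apply: ae_primeW => p _ /andP[]. Qed.

(** Carries along the coefficient condition that the clauses of [is_per_hat] require, so that [per]
    can be evaluated on finite expressions. *)
Definition represents (f : ser) (x : Arep) : Prop := inZser f /\ eqA (per f) x.

Lemma represents_integral f x n : represents f x ->
  ae_prime (fun p => p_integral p (x n p)).
Proof.
move=> [hf e]; apply: ae_primeW (ae_primeI (per_integral n hf) (e n)) => p pp [h].
by move=> /congr_sym c; exact: congr_integral c h.
Qed.

Lemma represents_add f g x y :
  represents f x -> represents g y -> represents (ser_add f g) (Defs.addA x y).
Proof.
move=> [hf ef] [hg eg]; split; first by move=> n; exact: inZ_add.
have [_ [_ [/(_ f g hf hg) [e _] _]]] := hper; apply: eqA_trans e _ => n.
apply: ae_primeW (ae_primeI (ef n) (eg n)) => p _ [].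
exact: congrD.
Qed.

Lemma represents_mul f g x y :
  represents f x -> represents g y -> represents (ser_mul f g) (Defs.mulA x y).
Proof.
move=> rf rg; have [hf ef] := rf; have [hg eg] := rg; split.
  by move=> n; apply: inZ_sum => i _; exact: inZ_mul.
have [_ [_ [/(_ f g hf hg) [_ e] _]]] := hper; apply: eqA_trans e _ => n.
apply: ae_primeW (ae_primeI (ae_primeI (ef n) (eg n))
  (ae_primeI (per_integral n hg) (represents_integral n rf))) => p _ [[h1 h2] [h3 h4]].
exact: congrM.
Qed.

Lemma represents_scale (z : int) f x :
  represents f x -> represents (ser_scale z%:~R f) (Defs.scaleA z%:~R x).
Proof.
move=> [hf ef]; split; first by move=> n; apply: inZ_mul => //; exact: inZ_rat.
have [_ [_ [_ [/(_ z%:~R f hf) e _]]]] := hper; apply: eqA_trans e _ => n.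
apply: ae_primeW (ef n) => p _; apply: congrMl; exact: p_integral_int.
Qed.

Definition ser_tX (m : nat) : ser := fun n => if n == m then 1 else 0.

Lemma inZ_ser_tX m : inZser (ser_tX m).
Proof. by move=> n; rewrite /ser_tX; case: eqP => _; [exact: inZ1|exact: inZ0]. Qed.

Lemma ser_tX_mul m f n :
  ser_mul (ser_tX m) f n = if (m <= n)%N then f (n - m)%N else 0.
Proof.
rewrite /ser_mul /ser_tX; case: leqP => h.
  rewrite (bigD1 (Ordinal (h : (m < n.+1)%N))) //= eqxx mul1r big1 ?addr0 // => i hi.
  by rewrite (_ : (i == m :> nat) = false) ?mul0r //; apply: contraNF hi.
by rewrite big1 // => -[i hi] _ /=; rewrite (_ : (i == m) = false) ?mul0r //; lia.
Qed.

Lemma represents_tX m : represents (ser_tX m) (fun _ p => (p ^ m)%:R).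
Proof.
have [_ [_ [_ [_ [h1 [_ [_ [_ [_ [ht _]]]]]]]]]] := hper.
elim: m => [|m IH]; first by split; [exact: inZ_ser_tX|].
rewrite (_ : ser_tX m.+1 = ser_mul (ser_tX 1) (ser_tX m)); last first.
  by apply/funext => -[|n]; rewrite ser_tX_mul /ser_tX //= subn1.
rewrite (_ : (fun _ _ => _) = Defs.mulA Defs.pA (fun _ p => (p ^ m)%:R)); last first.
  by apply/funext => n; apply/funext => p; rewrite /Defs.mulA /Defs.pA expnS natrM.
by apply: represents_mul => //; split; [exact: inZ_ser_tX|].
Qed.

Lemma represents_sum (I : eqType) (r : seq I) (F : I -> ser) (X : I -> Arep) :
  (forall i, i \in r -> represents (F i) (X i)) ->
  represents (fun n => \sum_(i <- r) F i n) (fun n p => \sum_(i <- r) X i n p).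
Proof.
elim: r => [|i r IH] h.
  have := represents_scale 0 (represents_tX 0); congr represents.
    by apply/funext => n; rewrite big_nil /ser_scale rmorph0 mul0r.
  by apply/funext => n; apply/funext => p; rewrite big_nil /Defs.scaleA mul0r.
have hi := represents_add (h i (mem_head _ _)) (IH (fun j hj => h j (mem_behead (s := i :: r) hj))).
move: hi; congr represents; first by apply/funext => n; rewrite big_cons.
by apply/funext => n; apply/funext => p; rewrite big_cons.
Qed.

Lemma congr_leW p n M x y : prime p -> (n <= M)%N -> congr_pn p M x y -> congr_pn p n x y.
Proof.
move=> pp /subnKC <- h.
have := p_integralM h (p_integral_nat p (p ^ (M - n))).
rewrite expnD natrM invfM mulrA mulfVK // pexp_neq0 //.
Qed.

Lemma per_zetaS k (a : int) : is_index k ->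
  eqA (per (subst_st (zetaS k) a)) (zetaA k a).
Proof.
move=> ik n.
have [_ [_ [hadd [_ [_ [_ [_ [hcont [_ [_ hzeta]]]]]]]]]] := hper.
(* [M >= N] puts the difference from the finite sum [F] within reach of continuity; [M >= n] makes
   the expansion of [zetaA] valid modulo p^n. *)
have [N hN] := hcont n; pose M := maxn N n.
(* These coefficients are integers, so scaling by them preserves congruences at every prime. *)
pose co m c : int := (- a) ^+ m * (bcoef k c)%:Z.
pose F n := \sum_(m <- index_iota 0 M) \sum_(c <- comps (size k) m)
  ser_scale (co m c)%:~R (ser_mul (ser_tX m) (zetaS0 (addseq k c))) n.
pose X n p := \sum_(m <- index_iota 0 M) \sum_(c <- comps (size k) m)
  Defs.scaleA (co m c)%:~R (Defs.mulA (fun _ p => (p ^ m)%:R) (zetaA (addseq k c) 0)) n p.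
have [hF eF] : represents F X.
  apply: represents_sum => m _; apply: represents_sum => c /mem_comps[ec _].
  apply: represents_scale; apply: represents_mul; first exact: represents_tX.
  have ikc := is_index_addseq ec ik.
  by split; [move=> j; exact: inZ_zetaS|exact: hzeta].
set G := subst_st (zetaS k) a.
have hG : inZser G by apply: inZ_subst_st => i j; exact: inZ_zetaS.
pose rest : ser := fun j => G j - F j.
have hrest : inZser rest by move=> j; exact: inZB.
have GE : G = ser_add F rest by apply/funext => j; rewrite /ser_add addrC subrK.
have rest0 : ser_ord_ge N rest.
  move=> j hj; rewrite (_ : rest j = 0); first exact: in_z2Z0.
  have hjM : (j < M)%N by rewrite leq_max hj.
  apply/eqP; rewrite subr_eq0; apply/eqP.
  rewrite /G subst_zetaS /F [RHS](@big_cat_nat _ _ _ j.+1) //=.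
  rewrite [X in _ + X]big_nat [X in _ + X]big1 ?addr0 => [|m /andP[hm _]].
    apply: eq_big_nat => m /andP[_ hm]; rewrite mulr_sumr.
    apply: eq_bigr => c _; rewrite /ser_scale ser_tX_mul -ltnS hm /co.
    by rewrite ratr_int rmorphM rmorphXn rmorphN /=; ring.
  rewrite big1 // => c _; rewrite /ser_scale ser_tX_mul.
  by rewrite leqNgt hm mulr0.
have [w [hw ew]] := hN rest hrest rest0.
have [e _] := hadd F rest hF hrest.
rewrite GE.
apply: ae_primeW (ae_primeI (ae_primeI (e n) (eF n)) (ae_primeI (ew n) (hw n))).
move=> p pp [[h1 h2] [h3 /andP[h4 _]]].
apply: congr_trans h1 _; apply: congr_trans (congrD h2 h3) _.
apply: congr_trans (_ : congr_pn p n _ (X n p)) _.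
  (* The image of [rest] is p^n times an integral element and disappears modulo p^n. *)
  rewrite /congr_pn addrC addKr mulrC mulKf // pexp_neq0 //.
have hMn : (n <= M)%N by rewrite leq_maxr.
apply: congr_sym; apply: congr_trans (congr_leW pp hMn (zetaA_expansion a k M n pp)) _.
rewrite (_ : \sum_(_ <= _ < _) _ = X n p); first exact: congr_refl.
apply: eq_bigr => m _; rewrite mulr_sumr; apply: eq_bigr => c _.
rewrite /Defs.scaleA /Defs.mulA /co !rmorphM /= rmorphXn rmorphN /= natrX -!pmulrn -mulNr exprMn.
by ring.
Qed.

End PerHat.

Theorem theorem7p3 (per : ser -> Arep) :
  is_per_hat per ->
  forall k : seq nat, is_index k ->
    [/\ inZser2 (zetaS k),
        (forall a : int, eqA (per (subst_st (zetaS k) a)) (zetaA k a)) &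
        (forall X : ser2, inZser2 X ->
           (forall a : int, eqA (per (subst_st X a)) (zetaA k a)) ->
           forall i j, in_z2Z (X i j - zetaS k i j))].
Proof.
move=> hper k ik.
have hS : inZser2 (zetaS k) by move=> i j; exact: inZ_zetaS.
split=> [//|a|X hX h i j]; first exact: per_zetaS.
(* Both series have the same image for every a; injectivity of [per] brings the equality back to
   coefficients modulo zeta(2). *)
apply: in_z2Z_unique => a.
have [_ [_ [_ [_ [_ [hinj _]]]]]] := hper; apply: hinj; try exact: inZ_subst_st.
by apply: eqA_trans (h a) (eqA_sym _); exact: per_zetaS.
Qed.
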